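(* Let $X$ be a standard Borel space and let $R$ be a Borel equivalence relation on $X$ that contains a treeable (Borel) subrelation $S\subset R$ of finite index. Then there exist a quasi-periodic countable $R$-set $E$ and an $R$-stable almost equality class $V$ over $E$ such that $V$ is a quasi-periodic $R$-space.
   Context: All sets, maps, equivalence relations and actions are Borel. An equivalence relation $R\subset X\times X$ is viewed as a groupoid: $(x,y)\in R$ is an arrow from $y$ to $x$, with $(x,y)(y,z)=(x,z)$. R-spaces. An $R$-space $Y$ is a field $(Y^x)_{x\in X}$ of standard Borel spaces with bijections $Y^y\to Y^x$, $v\mapsto (x,y)v$, for $(x,y)\in R$, functorial in $(x,y)$, such that the total space $Y=\bigsqcup_{x}Y^x$ carries a standard Borel structure for which the projection to $X$, the identification of each $Y^x$ with the fibre over $x$, and the action map $((x,y),v)\mapsto (x,y)v$ are Borel. If all $Y^x$ are countable sets, $Y$ is called a countable $R$-set. The orbit of $v\in Y^y$ is $\{(x,y)v:(x,y)\in R\}$. A fundamental domain is a Borel subset of $Y$ meeting every orbit exactly once; $Y$ is quasi-periodic if it admits a fundamental domain. Almost equality. For a countable set $F$, $(F,\mathbb Z_2)$ denotes the power set of $F$ (functions $F\to\mathbb Z_2=\mathbb Z/2\mathbb Z$). Two elements are almost equal if they differ at finitely many points; the equivalence classes are the almost equality classes. For a countable $R$-set $E$, $(E,\mathbb Z_2)$ denotes the field $x\mapsto (E^x,\mathbb Z_2)$ with its natural Borel structure and the $R$-action $((x,y)u)(e)=u((y,x)e)$, $u\in(E^y,\mathbb Z_2)$, $e\in E^x$. An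 $R$-stable almost equality class over $E$ is a Borel subfield $V\subset (E,\mathbb Z_2)$ such that $V^x$ is an almost equality class of $(E^x,\mathbb Z_2)$ for every $x\in X$ and $(x,y)V^y=V^x$ for all $(x,y)\in R$; it is an $R$-space for the restricted action. Treeability. A countable graph is a pair of countable sets (vertices, edges) with source and range maps from edges to vertices; a tree is a connected acyclic countable graph. A treeing of an equivalence relation $S$ on $X$ is a Borel subset $K\subset S$ such that the connected components of the graph with vertex set $X$ and edge set $K$ are the $S$-classes and the induced graph on every class is a tree. $S$ is treeable if it admits a treeing. Finite index. $S\subset R$ has index $n$ if there are Borel maps $f_1,\dots,f_n:X\to X$ such that for every $x$ the $S$-classes $S(f_1(x)),\dots,S(f_n(x))$ form a partition of the $R$-class $R(x)$ into $n$ classes. $S$ has finite index if $X$ is a finite disjoint union of $R$-invariant Borel sets on each of which $S$ has some finite index (so the number of $S$-classes in an $R$-class is bounded). *)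

(* Defs.v *)
From HB Require Import structures.
From mathcomp Require Import all_boot all_order all_algebra.
From mathcomp Require Import all_classical all_reals all_analysis.

Set Implicit Arguments.
Unset Strict Implicit.
Unset Printing Implicit Defensive.

Local Open Scope classical_set_scope.

(** [measurableType] is pointed, whereas the base space, an [R]-space or a
    total space may be empty here; hence sets with a sigma-algebra are bundled
    directly over the library's [sigma_algebra]. *)

Record borelType := BorelType {
  space :> Type;
  borel : set (set space);
  borelP : sigma_algebra setT borel
}.
Arguments borel : clear implicits.

(** [D] is meant to be Borel; cf. [measurable_fun]. *)
Definition borel_fun (X Y : borelType) (D : set X) (f : X -> Y) : Prop :=
  forall B, borel Y B -> borel X (D `&` f @^-1` B).

Definition prodB (X Y : borelType) : borelType :=
  @BorelType (X * Y) <<s [set A `*` B | A in borel X & B in borel Y] >>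
    (@smallest_sigma_algebra _ _ _).

Definition pullbackB (X : borelType) (T : Type) (j : T -> X) : borelType :=
  @BorelType T (preimage_set_system setT j (borel X))
    (sigma_algebra_preimage setT j (borelP X)).

Definition polish (K : realType) (P : metricType K) : Prop :=
  (forall F : set_system P, ProperFilter F -> cauchy F ->
     exists l : P, F --> l)
  /\ exists2 D : set P, countable D & dense D.

Definition standard_borel (K : realType) (X : borelType) : Prop :=
  exists (P : metricType K) (f : X -> P),
    [/\ polish P, bijective f &
        borel X = [set f @^-1` B | B in <<s @open P >>]].

(** [R (x, y)] says that [(x, y)] is an arrow from [y] to [x]. *)
Record borelEquiv (X : borelType) := BorelEquiv {
  equiv :> X * X -> Prop;
  equiv_borel : borel (prodB X X) equiv;
  equiv_refl : forall x, equiv (x, x);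
  equiv_sym : forall x y, equiv (x, y) -> equiv (y, x);
  equiv_trans : forall x y z, equiv (x, y) -> equiv (y, z) -> equiv (x, z)
}.

Definition class_of (X : borelType) (R : borelEquiv X) (x : X) : set X :=
  [set y | R (x, y)].

Definition invariant_under (X : borelType) (R : borelEquiv X) (A : set X) : Prop :=
  forall x y, R (x, y) -> A x -> A y.

Definition has_index_on (X : borelType) (S R : borelEquiv X) (A : set X)
    (n : nat) : Prop :=
  exists f : 'I_n -> X -> X,
    (forall i, borel_fun A (f i)) /\
    (forall x, A x ->
       partition [set: 'I_n] (fun i => class_of S (f i x)) (class_of R x)).

Definition finite_index (X : borelType) (S R : borelEquiv X) : Prop :=
  exists (m : nat) (A : 'I_m -> set X),
    [/\ \bigcup_i A i = [set: X], trivIset [set: 'I_m] A &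
        forall i, [/\ borel X (A i), invariant_under R (A i) &
                      exists n, has_index_on S R (A i) n]].

Record graph := Graph {
  vertex : Type;
  edge : Type;
  src : edge -> vertex;
  rng : edge -> vertex
}.

(** A walk may follow an edge forwards, [(e, true)], or backwards,
    [(e, false)]. *)
Definition osrc (G : graph) (a : edge G * bool) : vertex G :=
  if a.2 then src a.1 else rng a.1.
Definition orng (G : graph) (a : edge G * bool) : vertex G :=
  if a.2 then rng a.1 else src a.1.

Fixpoint walk (G : graph) (v : vertex G) (p : seq (edge G * bool))
    (w : vertex G) : Prop :=
  if p is a :: q then v = osrc a /\ walk (orng a) q w else v = w.

Fixpoint reduced (G : graph) (p : seq (edge G * bool)) : Prop :=
  if p is a :: q then
    (if q is b :: _ then ~ (a.1 = b.1 /\ a.2 = ~~ b.2) else True) /\ reduced q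
  else True.

Definition component (G : graph) (v : vertex G) : set (vertex G) :=
  [set w | exists p, walk v p w].

Definition connected_graph (G : graph) : Prop :=
  forall v w : vertex G, component v w.

(** Loops and multiple edges are circuits; in particular a treeing cannot
    contain both [(x, y)] and [(y, x)]. *)
Definition acyclic (G : graph) : Prop :=
  forall (v : vertex G) (p : seq (edge G * bool)),
    walk v p v -> reduced p -> p = [::].

Definition tree (G : graph) : Prop :=
  [/\ countable [set: vertex G], countable [set: edge G],
      connected_graph G & acyclic G].

Definition induced (G : graph) (A : set (vertex G)) : graph :=
  @Graph A [set e | A (src e) /\ A (rng e)]
    (fun e => SigSub (mem_set (set_valP e).1))
    (fun e => SigSub (mem_set (set_valP e).2)).

Definition graph_of (X : borelType) (T : set (X * X)) : graph :=
  @Graph X T (fun k => (val k).2) (fun k => (val k).1).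

Definition treeing (X : borelType) (S : borelEquiv X) (T : set (X * X)) :
    Prop :=
  [/\ borel (prodB X X) T, T `<=` S &
      forall x : X,
        @component (graph_of T) x = class_of S x /\
        tree (@induced (graph_of T) (class_of S x))].

Definition treeable (X : borelType) (S : borelEquiv X) : Prop :=
  exists T, treeing S T.

(** [Rfield] is the raw data of a field with an action and a sigma-algebra on
    its total space; the axioms are in [is_Rspace].  A fibre carries no Borel
    structure of its own: it is identified with a Borel subset of the total
    space, and its structure is the induced one. *)

Record Rfield (X : borelType) (R : borelEquiv X) := MkRfield {
  fiber : X -> Type;
  act : forall x y, R (x, y) -> fiber y -> fiber x;
  total_borel : set (set {x : X & fiber x});
  total_borelP : sigma_algebra setT total_borel
}.

Section Rspaces.
Variables (X : borelType) (R : borelEquiv X).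

Definition total (Y : Rfield R) : borelType := BorelType (total_borelP Y).

(** [((x, y), v) |-> (x, y) v], with a junk value when the pair is not
    composable. *)
Definition action_map (Y : Rfield R) (gv : prodB (prodB X X) (total Y)) :
    total Y :=
  match pselect (R (gv.1.1, projT1 gv.2)) with
  | left h => existT _ gv.1.1 (act h (projT2 gv.2))
  | right _ => gv.2
  end.

Definition composable (Y : Rfield R) : set (prodB (prodB X X) (total Y)) :=
  [set gv | R gv.1 /\ gv.1.2 = projT1 gv.2].

(** The two functoriality axioms make every [act h] bijective. *)
Record is_Rspace (K : realType) (Y : Rfield R) : Prop := IsRspace {
  act_id : forall x (h : R (x, x)) (v : fiber Y x), act h v = v;
  act_comp : forall x y z (h : R (x, y)) (k : R (y, z)) (l : R (x, z))
    (v : fiber Y z), act h (act k v) = act l v;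
  total_standard : standard_borel K (total Y);
  projection_borel : @borel_fun (total Y) X setT (@projT1 X (fiber Y));
  action_borel : borel_fun (@composable Y) (@action_map Y)
}.

Definition countable_Rset (K : realType) (Y : Rfield R) : Prop :=
  is_Rspace K Y /\ forall x, countable [set: fiber Y x].

Definition Rorbit (Y : Rfield R) (v : total Y) : set (total Y) :=
  [set w | exists (x : X) (h : R (x, projT1 v)),
             w = existT _ x (act h (projT2 v))].

Definition fundamental_domain (Y : Rfield R) (D : set (total Y)) : Prop :=
  borel (total Y) D /\ forall v : total Y, exists! w, D w /\ Rorbit v w.

Definition quasi_periodic (Y : Rfield R) : Prop :=
  exists D, @fundamental_domain Y D.

(** Its Borel structure is the coarsest one making Borel the projection to
    [X] and the evaluations [(x, u) |-> u (s x)] along the Borel partial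
    sections [s] of [E].  Such a section is given by its image [B], a Borel
    subset of [E] with at most one point in each fibre. *)

Definition power_fiber (E : Rfield R) (x : X) : Type := fiber E x -> 'Z_2.

Definition partial_section (E : Rfield R) (B : set (total E)) : Prop :=
  borel (total E) B /\
  forall v w, B v -> B w -> projT1 v = projT1 w -> v = w.

Definition evaluation_set (E : Rfield R) (B : set (total E)) (c : 'Z_2) :
    set {x : X & power_fiber E x} :=
  [set u | exists2 e : fiber E (projT1 u),
             B (existT _ (projT1 u) e) & (projT2 u : power_fiber E (projT1 u)) e = c].

Definition power_generators (E : Rfield R) :
    set (set {x : X & power_fiber E x}) :=
  [set @projT1 X (power_fiber E) @^-1` A | A in borel X] `|`
  [set evaluation_set B c | B in @partial_section E & c in [set: 'Z_2]].

Definition power_field (E : Rfield R) : Rfield R :=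
  @MkRfield X R (power_fiber E)
    (fun x y h u e => u (act (equiv_sym h) e))
    <<s @power_generators E >> (@smallest_sigma_algebra _ _ _).

Definition almost_equal (F : Type) (u v : F -> 'Z_2) : Prop :=
  finite_set [set e | u e <> v e].

Definition almost_equality_class (F : Type) (V : set (F -> 'Z_2)) : Prop :=
  exists u, V = [set v | almost_equal u v].

Record stable_almost_equality_class (E : Rfield R)
    (V : forall x, set (power_fiber E x)) : Prop := StableAEClass {
  class_borel : borel (total (power_field E)) [set u | V (projT1 u) (projT2 u)];
  class_ae : forall x, almost_equality_class (V x);
  class_stable : forall x y (h : R (x, y)), @act X R (power_field E) x y h @` V y = V x
}.

Section Restriction.
Variables (E : Rfield R) (V : forall x, set (power_fiber E x)).
Arguments V : clear implicits.
Hypothesis hV : stable_almost_equality_class V.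

Lemma class_act x y (h : R (x, y)) (u : power_fiber E y) :
  V y u -> V x (@act X R (power_field E) x y h u).
Proof. by move=> Vu; rewrite -(class_stable hV h); exists u. Qed.

Definition class_incl (u : {x : X & V x}) : total (power_field E) :=
  existT _ (projT1 u) (val (projT2 u)).

Definition class_field : Rfield R :=
  @MkRfield X R (fun x => V x)
    (fun x y h u => SigSub (mem_set (class_act h (set_valP u))))
    (borel (pullbackB class_incl)) (borelP (pullbackB class_incl)).

End Restriction.
End Rspaces.

(* Main.v *)
From HB Require Import structures.
Require Import Defs.
From mathcomp Require Import all_boot all_order all_algebra.
From mathcomp Require Import all_classical all_reals all_analysis.
From mathcomp Require Import lra.

Set Implicit Arguments.
Unset Strict Implicit.
Unset Printing Implicit Defensive.

Import Order.TTheory GRing.Theory Num.Theory.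
Local Open Scope classical_set_scope.

(** The quasi-periodic field consists of the edges: the fibre of [E] over [x]
    is the set of all edges of the treeing of [S] inside the [R]-class of [x],
    and [R] acts on it by forgetting over which point an edge is considered.
    An orbit is thus an edge, and it meets the fibre over the source of that
    edge exactly once, which gives a fundamental domain
    ([edge_quasi_periodic]).

    A subset of the fibre of [E] is an orientation of the edges.  A vertex [v]
    of a tree orients every edge of this tree towards itself, and two vertices
    give orientations that differ only on the geodesic between them
    ([toward_finite_diff]).  An [R]-class is a union of finitely many
    [S]-classes, hence of finitely many trees; so the orientations which, on
    each of these trees, agree up to finitely many edges with the orientation
    towards a vertex form a single almost equality class, the same over all
    points of the [R]-class ([tame_almost_equality_class], [tame_image]).

    Such a tame orientation has a sink in each tree: moving from a vertex along
    an edge that points away decreases the finite number of edges that are not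
    oriented towards the vertex ([sink_exists]).  It has finitely many sinks: if
    [w] is a sink other than [v], then the first edge on the way from [w] to [v]
    is among the finitely many that are not oriented towards [v]
    ([sinks_finite]).  The sinks depend on the orientation only, not on the
    base point, so that the pairs whose base point is the least sink, for a
    Borel linear order on [X], form a fundamental domain
    ([tame_quasi_periodic]).

    What remains is that everything is Borel.  All the conditions above become
    countable combinations of Borel conditions once the classes of [R] are
    enumerated by countably many Borel maps, which is the theorem of Lusin and
    Novikov ([borel_enumeration]); it also identifies the field of orientations
    with a Borel subset of the product of [X] with a Cantor space.  Its proof
    takes place in spaces of sequences.  Every Borel set there is the injective
    projection of a closed set ([borel_closed_lift]), and standard Borel
    spaces are the same as Borel sets of sequences ([standard_borel_code],
    [borel_code_standard]).  If a closed set could not be covered by countably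
    many Borel graphs, one could split it repeatedly into pieces that cannot be
    covered simultaneously over the same points, and would find a Cantor set in
    one of its fibres ([closed_countable_sections]); analytic separation
    ([analytic_separation]) is what makes an analytic graph part of a Borel
    one. *)

Arguments borel : simpl never.

(** * Borel sets and Borel maps *)

Section BorelSets.
Variable X : borelType.
Implicit Types A B : set X.

Lemma borel_ext A B : (forall x, A x <-> B x) -> borel X A -> borel X B.
Proof. by move=> AB; rewrite (_ : A = B)//; apply/seteqP; split=> x /AB. Qed.

Lemma borel_setC A : borel X A -> borel X (~` A).
Proof. by move=> bA; rewrite -setTD; case: (borelP X) => _ + _; exact. Qed.

Lemma borel_bigcup (F : nat -> set X) :
  (forall n, borel X (F n)) -> borel X (\bigcup_n F n).
Proof. by case: (borelP X) => _ _; exact. Qed.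

Lemma borel_const (P : Prop) : borel X [set _ | P].
Proof.
have b0 : borel X set0 by case: (borelP X).
case: (pselect P) => p; last by rewrite (_ : [set _ | P] = set0)// -subset0 =>
  ?.
rewrite (_ : [set _ | P] = ~` set0); first exact: borel_setC.
by rewrite setC0; apply/seteqP; split.
Qed.

Lemma borel_not A : borel X A -> borel X [set x | ~ A x].
Proof. exact: borel_setC. Qed.

Lemma borel_ex (I : countType) (F : I -> set X) :
  (forall i, borel X (F i)) -> borel X [set x | exists i, F i x].
Proof.
move=> bF; pose G n := if unpickle n is Some i then F i else set0.
rewrite (_ : [set x | _] = \bigcup_n G n).
  apply: borel_bigcup => n; rewrite /G; case: unpickle => //.
  exact: (borel_const False).
apply/seteqP; split=> [x [i Fx]|x [n _]].
  by exists (pickle i) => //; rewrite /G pickleK.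
by rewrite /G; case: unpickle => // i Fx; exists i.
Qed.

Lemma borel_all (I : countType) (F : I -> set X) :
  (forall i, borel X (F i)) -> borel X [set x | forall i, F i x].
Proof.
move=> bF; rewrite (_ : [set x | _] = ~` [set x | exists i, ~ F i x]).
  by apply/borel_setC/borel_ex => i; exact: borel_not.
apply/seteqP; split=> x /=; first by move=> h [i]; apply.
by move=> /forallNP h i; have /contrapT := h i.
Qed.

Lemma borel_or A B : borel X A -> borel X B -> borel X [set x | A x \/ B x].
Proof.
move=> bA bB; rewrite (_ : [set x | _] =
  [set x | exists b : bool, (if b then A else B) x]).
  by apply: borel_ex => -[].
apply/seteqP; split=> x /=; first by case; [exists true|exists false].
by case=> -[]; [left|right].
Qed.

Lemma borel_and A B : borel X A -> borel X B -> borel X [set x | A x /\ B x].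
Proof.
move=> bA bB; rewrite (_ : [set x | _] =
  [set x | forall b : bool, (if b then A else B) x]).
  by apply: borel_all => -[].
by apply/seteqP; split=> x /= => [[? ?] []//|h]; split;
  [apply: (h true)|apply: (h false)].
Qed.

Lemma borel_imp A B : borel X A -> borel X B -> borel X [set x | A x -> B x].
Proof.
move=> bA bB; rewrite (_ : [set x | _] = [set x | ~ A x \/ B x]).
  by apply: borel_or => //; exact: borel_not.
by apply/seteqP; split=> x /=; case: (pselect (A x)); tauto.
Qed.

Lemma borel_iff A B : borel X A -> borel X B -> borel X [set x | A x <-> B x].
Proof. by move=> bA bB; apply: borel_and; exact: borel_imp. Qed.

End BorelSets.

Definition borel_map (X Y : borelType) (f : X -> Y) : Prop :=
  forall B, borel Y B -> borel X [set x | B (f x)].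

Lemma borel_map_borel_fun (X Y : borelType) (f : X -> Y) : borel_map f ->
  @borel_fun X Y setT f.
Proof. by move=> bf B bB; rewrite setTI; exact: bf. Qed.

Lemma borel_map_id (X : borelType) : @borel_map X X id.
Proof. by []. Qed.

Lemma borel_map_comp (X Y Z : borelType) (g : Y -> Z) (f : X -> Y) :
  borel_map g -> borel_map f -> borel_map (fun x => g (f x)).
Proof. by move=> bg bf B /bg/bf. Qed.

Lemma borel_map_generated (X : borelType) (T : Type) (G : set (set T))
  (f : X -> T) :
  (forall B, G B -> borel X [set x | B (f x)]) ->
  @borel_map X (BorelType (smallest_sigma_algebra setT G)) f.
Proof.
move=> bf B bB; pose M := [set B : set T | borel X [set x | B (f x)]].
apply: (bB M); split => //; split; first exact: (borel_const X False).
  move=> A bA; rewrite /M /= (_ : mkset _ = [set x | ~ A (f x)]).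
    exact: borel_not.
  by apply/seteqP; split=> x /=; [case|].
move=> F bF; rewrite /M /= (_ : mkset _ = \bigcup_n [set x | F n (f x)]) //.
exact: borel_bigcup.
Qed.

Lemma borel_map_fst (X Y : borelType) : @borel_map (prodB X Y) X fst.
Proof.
move=> B bB; apply: sub_sigma_algebra; exists B => //; exists setT.
  exact: (borel_const Y True).
by apply/seteqP; split=> -[x y] //= [].
Qed.

Lemma borel_map_snd (X Y : borelType) : @borel_map (prodB X Y) Y snd.
Proof.
move=> B bB; apply: sub_sigma_algebra; exists setT.
  exact: (borel_const X True).
by exists B => //; apply/seteqP; split=> -[x y] //= [].
Qed.

Lemma borel_map_pair (X Y Z : borelType) (f : Z -> X) (g : Z -> Y) :
  borel_map f -> borel_map g -> @borel_map Z (prodB X Y) (fun z => (f z, g z)).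
Proof.
move=> bf bg; apply: borel_map_generated => _ [A bA [B bB <-]].
by apply: borel_and; [exact: bf|exact: bg].
Qed.

Lemma borel_map_pullback (X : borelType) (T : Type) (j : T -> X) :
  @borel_map (pullbackB j) X j.
Proof. by move=> B bB; exists B => //; rewrite setTI. Qed.

Lemma borel_map_cst (X Y : borelType) (y : Y) : @borel_map X Y (fun=> y).
Proof. by move=> B _; exact: borel_const. Qed.

Lemma borel_preimage (X Y : borelType) (f : X -> Y) (B : set Y) :
  borel_map f -> borel Y B -> borel X [set x | B (f x)].
Proof. exact. Qed.

Definition seqB (A : countType) : borelType :=
  BorelType (smallest_sigma_algebra setT
    [set [set z : nat -> A | z n = a] | n in [set: nat] & a in [set: A]]).

Lemma borel_digit (A : countType) n (a : A) : borel (seqB A) [set z | z n = a].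
Proof. by apply: sub_sigma_algebra; exists n => //; exists a. Qed.

Lemma borel_map_seq (X : borelType) (A : countType) (f : X -> nat -> A) :
  (forall n a, borel X [set x | f x n = a]) -> @borel_map X (seqB A) f.
Proof. by move=> bf; apply: borel_map_generated => _ [n _ [a _ <-]];
  exact: bf. Qed.

(** Since a digit takes countably many values, every condition on it, however
    complicated, is Borel. *)
Lemma borel_digit_in (X : borelType) (A : countType) (f : X -> seqB A) n
    (P : A -> Prop) :
  borel_map f -> borel X [set x | P (f x n)].
Proof.
move=> bf; rewrite (_ : mkset _ = [set x | exists a, f x n = a /\ P a]).
  apply: borel_ex => a; apply: borel_and; last exact: borel_const.
  exact: (bf _ (borel_digit n a)).
by apply/seteqP; split=> x /= => [Px|[_ [<-]]//]; exists (f x n).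
Qed.

Lemma borel_map_digits (X : borelType) (A B : countType) (f : X -> seqB A)
    (h : nat -> A -> B) (s : nat -> nat) :
  borel_map f -> @borel_map X (seqB B) (fun x n => h n (f x (s n))).
Proof.
by move=> bf; apply: borel_map_seq => n b;
  exact: (@borel_digit_in _ _ _ _ (fun a => h n a = b)).
Qed.

Lemma borel_seq_eq (X : borelType) (A : countType) (f g : X -> seqB A) :
  borel_map f -> borel_map g -> borel X [set x | f x = g x].
Proof.
move=> bf bg; rewrite (_ : mkset _ =
  [set x | forall n, exists a, f x n = a /\ g x n = a]).
  by apply: borel_all => n; apply: borel_ex => a; apply: borel_and;
     [exact: (bf _ (borel_digit n a))|exact: (bg _ (borel_digit n a))].
apply/seteqP; split=> x /=; first by move=> -> n; exists (g x n).
by move=> h; apply/funext => n; have [a [-> ->]] := h n.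
Qed.

Lemma borel_prefix (A : countType) (w : seq A) :
  borel (seqB A) [set z | mkseq z (size w) = w].
Proof.
elim/last_ind: w => [|w a bw];
  first exact: (borel_ext _ (@borel_const (seqB A) True)).
apply: (@borel_ext (seqB A)
  [set z : nat -> A | mkseq z (size w) = w /\ z (size w) = a]).
  move=> z /=; rewrite size_rcons mkseqS; split=> [[-> ->]//|].
  by move/rcons_inj => [-> ->].
by apply: borel_and; [exact: bw|exact: borel_digit].
Qed.

(** * Closed sets of sequences and Borel sets *)

Definition closed_seq (A : Type) (F : set (nat -> A)) : Prop :=
  forall z, (forall n, exists2 z', F z' & forall i, i < n -> z' i = z i) -> F z.

(** Such a [g] exhibits [D] as the bijective projection of a closed set, by a
    projection whose inverse is Borel. *)
Definition closed_lift (A : countType) (D : set (nat -> A))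
    (g : (nat -> A) -> nat -> nat) : Prop :=
  @borel_map (seqB A) (seqB nat) g /\
  closed_seq [set w : nat -> A * nat |
    D (fst \o w) /\ snd \o w = g (fst \o w)].

Section ClosedLift.
Variable A : countType.
Implicit Types D : set (nat -> A).

(** The lifts for the individual sets are written side by side: the digit of
    index [pickle (n, k)] is the digit of index [k] of the [n]-th lift. *)
Lemma closed_lift_bigcap (D : nat -> set (nat -> A)) g :
  (forall n, closed_lift (D n) (g n)) -> exists h,
    closed_lift (\bigcap_n D n) h.
Proof.
move=> gD.
pose h x m := if @pickle_inv (nat * nat)%type m is Some p then g p.1 x p.2
              else 0.
exists h; split.
  apply: borel_map_seq => m a; rewrite /h; case: pickle_inv => [[n k]|] /=.
    exact: ((gD n).1 _ (borel_digit k a)).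
  exact: borel_const.
move=> w wlim.
have lift_n n : D n (fst \o w) /\
    (fun k => (w (pickle (n, k))).2) = g n (fst \o w).
  apply: ((gD n).2 (fun k => ((w k).1, (w (pickle (n, k))).2))) => N.
  (* The first [N] digits of the [n]-th lift are among the first [M] digits. *)
  pose M := N + \max_(k < N) (pickle (n, nat_of_ord k)).+1.
  have [w' [Dw' gw'] ww'] := wlim M.
  exists (fun k => ((w' k).1, (w' (pickle (n, k))).2)).
    split; first exact: (Dw' n).
    apply/funext => k /=; have /(congr1 (fun f => f (pickle (n, k)))) := gw'.
    by rewrite /= /h pickleK_inv.
  move=> k kN; rewrite !ww'//; last by rewrite (leq_trans kN)// leq_addr.
  apply: (leq_trans _ (leq_addl _ _)).
  exact: (@leq_bigmax _ (fun k : 'I_N => (pickle (n, nat_of_ord k)).+1)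
    (Ordinal kN)).
split=> [n _|]; first exact: (lift_n n).1.
apply/funext => m /=; rewrite /h.
case E : pickle_inv => [[n k]|].
  have := @pickle_invK (nat * nat)%type m; rewrite E /= => <-.
  by have /(congr1 (fun f => f k)) := (lift_n n).2.
have [w' [_ e] ww'] := wlim m.+1; rewrite -ww'//.
by have := congr1 (fun f => f m) e; rewrite /= /h E.
Qed.

(** The first digit of the lift tells in which of the disjoint sets the point
    lies, so that the approximants of a limit point eventually lie in one of
    them. *)
Lemma closed_lift_bigcup (D : nat -> set (nat -> A)) g :
  (forall n, borel (seqB A) (D n)) ->
  (forall n m x, D n x -> D m x -> n = m) ->
  (forall n, closed_lift (D n) (g n)) ->
  exists h, closed_lift (\bigcup_n D n) h.
Proof.
move=> bD disj gD; pose idx x := xget 0 [set n | D n x].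
have idxE n x : D n x -> idx x = n.
  by move=> Dx; rewrite /idx; case: xgetP => [m _ /disj|/(_ n)//]; apply.
have b_idx n : borel (seqB A) [set x | idx x = n].
  rewrite (_ : mkset _ = [set x | D n x \/ n = 0 /\ forall m, ~ D m x]).
    apply: borel_or; first exact: bD.
    apply: borel_and; first exact: borel_const.
    by apply: borel_all => m; exact: borel_not.
  apply/seteqP; split=> x /=.
    by rewrite /idx; case: xgetP => [m -> /= Dx <-|h <-]; [left|right].
  case=> [/idxE//|[-> h]]; rewrite /idx; case: xgetP => // m _ Dx.
  by case: (h m).
pose h x k := if k is k'.+1 then g (idx x) x k' else idx x.
exists h; split.
  apply: borel_map_seq => -[|k] a; first exact: b_idx.
  rewrite (_ : mkset _ = [set x | exists n, idx x = n /\ g n x k = a]).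
    apply: borel_ex => n; apply: borel_and; first exact: b_idx.
    exact: ((gD n).1 _ (borel_digit k a)).
  by apply/seteqP; split=> x /= => [<-|[_ [<-]]//]; exists (idx x).
move=> w wlim; set n := (w 0).2.
have [Dw gw] : D n (fst \o w) /\ (fun k => (w k.+1).2) = g n (fst \o w).
  apply: ((gD n).2 (fun k => ((w k).1, (w k.+1).2))) => N.
  have [w' [[m _ Dw'] gw'] ww'] := wlim N.+1.
  have hw' k : (w' k).2 = h (fst \o w') k by rewrite -gw'.
  have mn : m = n by rewrite /n -ww'// hw' /= (idxE m).
  exists (fun k => ((w' k).1, (w' k.+1).2)).
    rewrite -mn; split => //; apply/funext => k /=.
    by rewrite hw' /= (idxE m).
  by move=> k kN; rewrite !ww'//; exact: ltnW.
split; first by exists n.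
apply/funext => -[|k] /=; first by rewrite (idxE n).
by rewrite (idxE n)// -gw.
Qed.

(** The sets which have a closed lift, and whose complement has one too,
    contain the cylinders and are stable under complements; they are stable
    under countable unions because these can be made disjoint by means of
    countable intersections. *)
Lemma borel_closed_lift D :
  borel (seqB A) D -> exists g, closed_lift D g.
Proof.
pose M := [set D | [/\ borel (seqB A) D, exists g, closed_lift D g &
                      exists g, closed_lift (~` D) g]].
suff sM : M `<=` M /\ sigma_algebra setT M.
  move=> bD; have [] // : M D; apply: (bD M); split; first exact: sM.2.
  move=> _ [n _ [a _ <-]]; have b0 :
    @borel_map (seqB A) (seqB nat) (fun=> fun=> 0).
    exact: borel_map_cst.
  have closed0 (P : A -> Prop) :
    closed_lift [set z : nat -> A | P (z n)] (fun=> fun=> 0).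
    split=> // w wlim; split=> /=.
      by have [w' [/= Pw' _] <-//] := wlim n.+1.
    apply/funext => k /=.
    have [w' [_ e] ww'] := wlim k.+1.
    by have := congr1 (fun f => f k) e; rewrite /= ww'.
  split; first exact: borel_digit.
    by exists (fun=> fun=> 0); exact: (closed0 (fun b => b = a)).
  by exists (fun=> fun=> 0); exact: (closed0 (fun b => b <> a)).
split=> //; have cap (G : nat -> set (nat -> A)) :
    (forall n, exists g, closed_lift (G n) g) ->
    exists g, closed_lift (\bigcap_n G n) g.
  by move=> /choice[g]; exact: closed_lift_bigcap.
split.
- split; first exact: (@borel_const (seqB A) False).
    exists (fun=> fun=> 0); split; first exact: borel_map_cst.
    by move=> w /(_ 0)[? []].
  rewrite setC0; exists (fun=> fun=> 0); split; first exact: borel_map_cst.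
  move=> w wlim; split=> //; apply/funext => k /=.
  have [w' [_ e] ww'] := wlim k.+1.
  by have := congr1 (fun f => f k) e; rewrite /= ww'.
- by move=> B [bB gB gB']; rewrite setTD; split=> //;
  [exact: borel_setC|rewrite setCK].
- move=> F MF; split.
  + by apply: borel_bigcup => n; case: (MF n).
  + pose G n k := if k < n then ~` F k else F n.
    have <- : \bigcup_n \bigcap_k G n k = \bigcup_n F n.
      apply/seteqP; split=> x [n _].
        by move=> /(_ n I); rewrite /G ltnn => Fx; exists n.
      move=> Fnx; have ex : exists n, `[<F n x>] by exists n; exact/asboolP.
      case: (ex_minnP ex) => m /asboolP Fm mmin; exists m => // k _.
      rewrite /G; case: ifP => // km Fk.
      by have := mmin k (asboolT Fk); rewrite leqNgt km.
    have /choice[g gG] n : exists g, closed_lift (\bigcap_k G n k) g.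
      by apply: cap => k; rewrite /G; case: ifP => _;
        [case: (MF k)|case: (MF n)].
    apply: (closed_lift_bigcup _ _ gG) => [n|n m x Gn Gm].
      rewrite (_ : \bigcap_k _ = [set x | forall k, G n k x]).
        apply: borel_all => k; rewrite /G; case: ifP => _; last by case: (MF n).
        by apply: borel_setC; case: (MF k).
      by apply/seteqP; split=> x /= h k; [exact: h|move=> _; exact: h].
    have Fn : F n x by have := Gn n I; rewrite /G ltnn.
    have Fm : F m x by have := Gm m I; rewrite /G ltnn.
    case: (ltngtP n m) => // nm; first by have := Gm n I; rewrite /G nm.
    by have := Gn m I; rewrite /G nm.
  + by rewrite setC_bigcup; apply: cap => n; case: (MF n).
Qed.

End ClosedLift.

(** * Standard Borel spaces as Borel sets of sequences *)

(** Standard Borel spaces are handled through such codes: products and Borel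
    subsets are simpler to treat in a space of sequences than in an abstract
    Polish space. *)
Definition borel_code (Y : borelType) (A : countType) (j : Y -> nat -> A) :
  Prop :=
  [/\ injective j, borel Y = borel (@pullbackB (seqB A) Y j) &
      borel (seqB A) (range j)].

(** An alias of [T] carrying the first-difference ultrametric transported along
    [j]: the distance is the inverse of one plus the first index of
    disagreement. *)
Definition seq_metric (K : realType) (T : Type) (B : countType)
  (j : T -> nat -> B) (injj : injective j) : Type := T.

Section SeqMetric.
Variables (K : realType) (T : Type) (B : countType).
Variables (j : T -> nat -> B) (injj : injective j).
Local Notation M := (seq_metric K injj).
Local Open Scope ring_scope.

HB.instance Definition _ := gen_eqMixin M.
HB.instance Definition _ := gen_choiceMixin M.

Definition seq_dist (x y : M) : K :=
  if @first_diff (fun=> B) (j x) (j y) is Some n then n.+1%:R^-1 else 0.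

Lemma seq_dist_lt (x y : M) N :
  seq_dist x y < N.+1%:R^-1 <-> forall i, (i < N.+1)%N -> j x i = j y i.
Proof.
rewrite /seq_dist; case E : first_diff => [n|].
  have [pre diff] := (@first_diff_SomeP (fun=> B) _ _ _).1 E.
  rewrite ltf_pV2 ?posrE ?ltr0n// ltr_nat; split.
    move=> Nn i iN; apply: pre; rewrite ltEnat /=.
    by rewrite (leq_trans iN).
  move=> h; rewrite ltnNge; apply/negP => nN.
  by move: diff; rewrite h ?eqxx.
have := (@first_diff_NoneP (fun=> B) _ _).2 E => ->; split=> _ //.
Qed.

Lemma seq_distxx (x : M) : seq_dist x x = 0.
Proof. by rewrite /seq_dist (@first_diff_NoneP (fun=> B) _ _).1. Qed.

Lemma seq_dist_eq0 (x y : M) : seq_dist x y = 0 -> x = y.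
Proof.
rewrite /seq_dist; case E : first_diff => [n|].
  by move/eqP; rewrite invr_eq0 pnatr_eq0.
by move=> _; apply/injj/(@first_diff_NoneP (fun=> B)).
Qed.

Lemma seq_dist_sym (x y : M) : seq_dist x y = seq_dist y x.
Proof. by rewrite /seq_dist first_diff_sym. Qed.

Lemma seq_dist_triangle (y x z : M) :
  seq_dist x z <= seq_dist x y + seq_dist y z.
Proof.
have ge0 a b : 0 <= seq_dist a b.
  by rewrite /seq_dist; case: first_diff => // n; rewrite invr_ge0 ler0n.
rewrite leNgt; apply/negP => h.
have hx : seq_dist x y < seq_dist x z by apply: le_lt_trans h; rewrite lerDl.
have hz : seq_dist y z < seq_dist x z by apply: le_lt_trans h; rewrite lerDr.
case E : (@first_diff (fun=> B) (j x) (j z)) => [n|]; last first.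
  have dxz : seq_dist x z = 0 by rewrite /seq_dist E.
  by move: hx; rewrite dxz ltNge ge0.
have dxz : seq_dist x z = n.+1%:R^-1 by rewrite /seq_dist E.
move: hx hz; rewrite dxz => /seq_dist_lt hx /seq_dist_lt hz.
have [_] := (@first_diff_SomeP (fun=> B) _ _ _).1 E.
by rewrite hx// hz// eqxx.
Qed.

HB.instance Definition _ := isMetric.Build K M
  seq_distxx seq_dist_eq0 seq_dist_sym seq_dist_triangle.

Lemma seq_ballP (x y : M) N :
  ball x (N.+1%:R^-1 : K) y <-> forall i, (i < N.+1)%N -> j x i = j y i.
Proof. by rewrite ballEmdist; exact: seq_dist_lt. Qed.

Lemma seq_nbhsP (x : M) (U : set M) :
  nbhs x U <-> exists N, forall y : M,
    (forall i, (i < N.+1)%N -> j x i = j y i) -> U y.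
Proof.
split=> [/nbhs_ballP[e /= e0 eU]|[N NU]].
  have [N Ne] : exists N, N.+1%:R^-1 < e.
    exists (Num.truncn e^-1); rewrite invf_plt ?posrE// ?ltr0n//.
    by have /truncn_itv/andP[] : 0 <= e^-1 by rewrite invr_ge0 ltW.
  exists N => y /seq_ballP; move=> xy; apply: eU; exact: (le_ball (ltW Ne)).
apply/nbhs_ballP; exists (N.+1%:R^-1) => /=; first by rewrite invr_gt0 ltr0n.
by move=> y /seq_ballP/NU.
Qed.

(** A Cauchy filter fixes more and more digits, and the sequence of all these
    digits comes from a point when the range is closed.  Choosing a point in
    each nonempty cylinder gives a countable dense set. *)
Lemma seq_polish : closed_seq (range j) -> @polish K M.
Proof.
move=> cl; split=> [F PF /cauchyP cF|].
  have /choice[x Fx] N : exists x : M, F (ball x (N.+1%:R^-1 : K)).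
    by apply: cF; rewrite invr_gt0 ltr0n.
  have agree N N' i : (i < N.+1)%N -> (i < N'.+1)%N -> j (x N) i = j (x N') i.
    move=> iN iN'; have [y [/seq_ballP xy /seq_ballP xy']] :=
      filter_ex (filterI (Fx N) (Fx N')).
    by rewrite xy// xy'.
  have [l _ jl] : range j (fun n => j (x n) n).
    apply: cl => n; exists (j (x n)); first by exists (x n).
    by move=> i ni; apply: agree => //; exact: ltnW.
  exists l => U /seq_nbhsP[N NU]; apply: filterS (Fx N) => y /seq_ballP xy.
  by apply: NU => i iN; rewrite -xy// jl; exact: agree.
pose hit (w : seq B) (y : M) := mkseq (j y) (size w) = w.
have /choice[G hG] (w : seq B) : exists G : set M, countable G /\
    ((exists y, hit w y) -> exists2 y, G y & hit w y).
  case: (pselect (exists y, hit w y)) => [[y wy]|nh].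
    by exists [set y]; split; [exact: countable1|exists y].
  by exists set0; split => //; exact: countable0.
exists (\bigcup_w G w).
  by apply: bigcup_countable => // w _; exact: (hG w).1.
move=> O [x Ox]; rewrite openE => /(_ x Ox)/seq_nbhsP[N NO].
have [|y Gy hy] := (hG (mkseq (j x) N.+1)).2.
  by exists x; rewrite /hit size_mkseq.
exists y; split; last by exists (mkseq (j x) N.+1).
apply: NO => i iN; move: hy; rewrite /hit size_mkseq.
by move=> /(congr1 (fun s => nth (j x 0) s i)); rewrite !nth_mkseq.
Qed.

Lemma seq_open_borel :
  <<s @open M >> = preimage_set_system setT j (borel (seqB B)).
Proof.
apply/seteqP; split.
  apply: smallest_sub; first exact: (borelP (@pullbackB (seqB B) T j)).
  move=> O oO.
  exists [set z | exists w : seq B,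
    (forall y : M, mkseq (j y) (size w) = w -> O y) /\ mkseq z (size w) = w].
    apply: borel_ex => w; apply: borel_and; first exact: borel_const.
    exact: borel_prefix.
  rewrite setTI; apply/seteqP; split=> [y [w [h /h//]]|y Oy].
  have := oO; rewrite openE => /(_ y Oy)/seq_nbhsP[N NO].
  exists (mkseq (j y) N.+1); rewrite size_mkseq; split=> // z zy.
  apply: NO => i iN.
  by have := congr1 (fun s => nth (j y 0) s i) zy; rewrite !nth_mkseq.
move=> _ [D bD <-]; rewrite setTI.
pose Mb := BorelType (smallest_sigma_algebra setT (@open M)).
apply: (@borel_map_seq Mb B j _ D bD) => n b; apply: sub_sigma_algebra.
rewrite /= openE => y /= yb; apply/seq_nbhsP; exists n => z /(_ n (ltnSn n)).
by rewrite yb.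
Qed.

End SeqMetric.

(** A Borel set of sequences need not be closed, but adding the digits of its
    closed lift makes it so without changing the Borel structure. *)
Lemma borel_code_standard (K : realType) (Y : borelType) (A : countType)
    (j : Y -> nat -> A) :
  borel_code j -> standard_borel K Y.
Proof.
move=> [injj bY bD]; have [g [bg clg]] := borel_closed_lift bD.
pose j' (y : Y) (n : nat) := (j y n, g (j y) n).
have injj' : injective j'.
  move=> x y e; apply: injj; apply/funext => n.
  by have := congr1 (fun f => (f n).1) e.
have bj' : @borel_map Y (seqB (A * nat)%type) j'.
  have bj : @borel_map Y (seqB A) j.
    by move=> B bB; rewrite bY; exact: borel_map_pullback.
  apply: borel_map_seq => n [a k].
  rewrite (_ : mkset _ = [set y | j y n = a /\ g (j y) n = k]).
    apply: borel_and; first exact: (bj _ (borel_digit n a)).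
    exact: (bj _ (bg _ (borel_digit n k))).
  by apply/seteqP; split=> y; rewrite /j' /= => -[-> ->].
exists (seq_metric K injj'), id; split.
- apply: seq_polish => w wlim.
  have [n|[y _ jy] gw] := clg w.
    by have [_ [y _ <-] h] := wlim n; exists (j' y) => //; split=> //; exists y.
  exists y => //; apply/funext => n; rewrite /j' jy.
  by have := congr1 (fun f => f n) gw; rewrite /= [w n]surjective_pairing => <-.
- by exists id.
- rewrite seq_open_borel; apply/seteqP; split=> U.
    rewrite bY => -[B bB <-].
    exists (j' @^-1` [set w | B (fst \o w)]); last first.
      by rewrite setTI; apply/seteqP; split.
    exists [set w : nat -> A * nat | B (fst \o w)]; last by rewrite setTI.
    exact: (@borel_map_digits (seqB (A * nat)%type) _ A id (fun=> fst) id _ B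
      bB).
  by move=> [_ [B bB <-] <-]; rewrite setTI; exact: bj'.
Qed.

Definition inv_succ (K : realType) (n : nat) : K := (n.+1%:R^-1)%R.

Section PolishCode.
Variables (K : realType) (P : metricType K).
Local Open Scope ring_scope.
Local Notation eps := (inv_succ K).

Lemma inv_succ_gt0 n : 0 < eps n.
Proof. by rewrite /inv_succ invr_gt0 ltr0n. Qed.

Lemma inv_succ_small (e : K) : 0 < e -> exists N, forall n, (N <= n)%N ->
  eps n < e.
Proof.
move=> e0; exists (Num.truncn e^-1) => n Nn.
rewrite /inv_succ invf_plt ?posrE// ?ltr0n//.
have /truncn_itv/andP[_ h] : 0 <= e^-1 by rewrite invr_ge0 ltW.
by rewrite (lt_le_trans h)// ler_nat.
Qed.

Lemma open_mdist_lt (x : P) (e : K) : open [set y | mdist x y < e].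
Proof.
rewrite openE => y /= xy; apply/nbhs_ballP; exists (e - mdist x y) => /=.
  by rewrite subr_gt0.
move=> z; rewrite ballEmdist /= => yz.
by rewrite (le_lt_trans (metric_triangle x y z))// -ltrBrDl.
Qed.

Variable d : nat -> P.
Hypothesis dense_d : dense (range d).

Definition first_near (p : P) n k :=
  mdist (d k) p < eps n /\ forall i, (i < k)%N -> ~ mdist (d i) p < eps n.

Lemma first_near_ex p n : exists k, first_near p n k.
Proof.
have [|q [/= dp [k _ dk]]] := dense_d _ (@open_mdist_lt p (eps n)).
  by exists p; rewrite /= mdistxx inv_succ_gt0.
have ex : exists k, mdist (d k) p < eps n.
  by exists k; rewrite dk metric_sym.
case: (ex_minnP ex) => m dm mmin; exists m; split=> // i im di.
by have := mmin i di; rewrite leqNgt im.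
Qed.

Lemma first_near_unique p n k l : first_near p n k -> first_near p n l -> k = l.
Proof.
move=> [hk mk] [hl ml]; case: (ltngtP k l) => // kl.
  by case: (ml k kl).
by case: (mk l kl).
Qed.

(** When the points [d (z m)] approximate [p], this says that
    [mdist (d k) p < eps n] without mentioning [p]. *)
Definition limit_near (z : nat -> nat) n k :=
  exists i M, forall m, (M <= m)%N -> mdist (d k) (d (z m)) <= eps n - eps i.

Lemma limit_nearP z p n k : (forall m, mdist (d (z m)) p <= eps m) ->
  limit_near z n k <-> mdist (d k) p < eps n.
Proof.
move=> zp; split=> [[i [M h]]|kp].
  have [N hN] := inv_succ_small (inv_succ_gt0 i).
  have {h} := h _ (leq_maxl M N); have {hN} := hN _ (leq_maxr M N).
  have := zp (maxn M N); have := metric_triangle (d k) (d (z (maxn M N))) p.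
  move: (eps (maxn M N)) => e; lra.
have [i hi] : exists N, forall m, (N <= m)%N ->
  eps m < (eps n - mdist (d k) p) / 2.
  by apply: inv_succ_small; rewrite divr_gt0// subr_gt0.
exists i, i => m /hi h; have {hi} := hi i (leqnn i).
have := metric_triangle (d k) p (d (z m)); rewrite (metric_sym p).
by have := zp m; move: h; lra.
Qed.

(** The sequences [z] such that [d \o z] converges fast enough and every [z n]
    is the first index whose point is within [eps n] of the limit. *)
Definition limit_codes : set (nat -> nat) := [set z |
  (forall n m, mdist (d (z n)) (d (z m)) < eps n + eps m) /\
  forall n, limit_near z n (z n) /\
    forall k, (k < z n)%N -> ~ limit_near z n k].

Lemma borel_limit_codes : borel (seqB nat) limit_codes.
Proof.
have bn n (k : nat) : borel (seqB nat) [set z | limit_near z n k].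
  apply: borel_ex => i; apply: borel_ex => M; apply: borel_all => m.
  apply: borel_imp; first exact: borel_const.
  exact: (@borel_digit_in (seqB nat) _ id m
    (fun a => mdist (d k) (d a) <= eps n - eps i)).
apply: borel_and.
  apply: borel_all => n; apply: borel_all => m.
  apply: (@borel_ext (seqB nat) [set z : nat -> nat | exists a : nat, z n = a /\
     mdist (d a) (d (z m)) < eps n + eps m]).
    by move=> z /=; split=> [[_ [->]]//|h]; exists (z n).
  apply: borel_ex => a; apply: borel_and; first exact: borel_digit.
  exact: (@borel_digit_in (seqB nat) _ id m
    (fun b => mdist (d a) (d b) < eps n + eps m)).
apply: borel_all => n.
apply: (@borel_ext (seqB nat) [set z : nat -> nat | exists a : nat, z n = a /\
   (limit_near z n a /\ forall k, (k < a)%N -> ~ limit_near z n k)]).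
  by move=> z /=; split=> [[_ [->]]//|h]; exists (z n).
apply: borel_ex => a; apply: borel_and; first exact: borel_digit.
apply: borel_and; first exact: bn.
apply: borel_all => k; apply: borel_imp; first exact: borel_const.
by apply: borel_not; exact: bn.
Qed.

(** A point is coded by the indices of the first points of the dense sequence
    at distance less than [eps n], for all [n]. *)
Lemma dense_code : (forall F : set_system P, ProperFilter F -> cauchy F ->
     exists l : P, F --> l) ->
  exists c : P -> nat -> nat, [/\ injective c,
    <<s @open P >> = preimage_set_system setT c (borel (seqB nat)) &
    borel (seqB nat) (range c)].
Proof.
move=> complete.
have /choice[c hc] p : exists c, forall n, first_near p n (c n).
  by have [c hc] := choice (first_near_ex p); exists c.
have close p m : mdist (d (c p m)) p <= eps m by apply/ltW; case: (hc p m).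
exists c; split.
- move=> p q pq; apply: mdist_positivity; apply/eqP;
  rewrite eq_le mdist_ge0 andbT.
  rewrite leNgt; apply/negP => h.
  have [N /(_ N (leqnn N))] : exists N, forall m, (N <= m)%N ->
    eps m < mdist p q / 2.
    by apply: inv_succ_small; rewrite divr_gt0.
  have := metric_triangle p (d (c p N)) q; rewrite (metric_sym p (d _)).
  have := close p N; have := close q N; rewrite -pq; lra.
- pose Pb := BorelType (smallest_sigma_algebra setT (@open P)).
  have bo (O : set P) : open O -> borel Pb O by exact: sub_sigma_algebra.
  apply/seteqP; split.
    apply: smallest_sub; first exact: (borelP (@pullbackB (seqB nat) P c)).
    move=> O oO; exists [set z : nat -> nat | exists n k, z n = k /\
        forall q, mdist (d k) q < eps n -> O q].
      apply: borel_ex => n; apply: borel_ex => k; apply: borel_and.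
        exact: borel_digit.
      exact: borel_const.
    rewrite setTI; apply/seteqP; split=> p /=.
      by move=> [n [k [<- h]]]; apply: h; case: (hc p n).
    have := oO; rewrite openE => /[apply] /nbhs_ballP[e /= e0 eO].
    have [N /(_ N (leqnn N)) hN] : exists N, forall m, (N <= m)%N ->
      eps m < e / 2.
      by apply: inv_succ_small; rewrite divr_gt0.
    exists N, (c p N); split=> // q hq; apply: eO; rewrite ballEmdist /=.
    have := metric_triangle p (d (c p N)) q; rewrite (metric_sym p (d _)).
    by have := close p N; move: hq hN; lra.
  move=> _ [D bD <-]; rewrite setTI.
  apply: (@borel_map_seq Pb nat c _ D bD) => n k.
  apply: (@borel_ext Pb [set p | first_near p n k]).
    by move=> p; split=> [h|<-];
      [exact: first_near_unique (hc p n) h|exact: hc].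
  apply: borel_and; first by apply: bo; exact: open_mdist_lt.
  apply: borel_all => i; apply: borel_imp; first exact: borel_const.
  by apply: borel_not; apply: bo; exact: open_mdist_lt.
- rewrite (_ : range c = limit_codes); first exact: borel_limit_codes.
  apply/seteqP; split=> [_ [p _ <-]|z [zc zn]].
    split=> [n m|n].
      have := metric_triangle (d (c p n)) p (d (c p m)).
      rewrite (metric_sym p).
      by have [+ _] := hc p n; have [+ _] := hc p m; lra.
    have [h1 h2] := hc p n; split; first exact/(limit_nearP _ _ (close p)).
    by move=> k /h2 + /(limit_nearP _ _ (close p)).
  have [p hp] : exists p : P, d \o z @ \oo --> p.
    apply: complete; apply/cauchy_exP => e e0.
    have [N hN] : exists N, forall m, (N <= m)%N -> eps m < e / 2.
      by apply: inv_succ_small; rewrite divr_gt0.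
    exists (d (z N)); exists N => // m /= Nm; rewrite ballEmdist /=.
    by have := zc N m; have := hN N (leqnn N); have := hN m Nm; lra.
  have zp m : mdist (d (z m)) p <= eps m.
    rewrite leNgt; apply/negP => h.
    have [N hN] : exists N, forall k, (N <= k)%N ->
        eps k < (mdist (d (z m)) p - eps m) / 2.
      by apply: inv_succ_small; rewrite divr_gt0// subr_gt0.
    have /(metricType_numDomainType.cvgr_dist_lt hp)[M _ hM] :
      0 < (mdist (d (z m)) p - eps m) / 2 by rewrite divr_gt0// subr_gt0.
    have /= := hM (maxn M N) (leq_maxl _ _); have :=
      hN (maxn M N) (leq_maxr _ _).
    have := zc m (maxn M N); have :=
      metric_triangle (d (z m)) (d (z (maxn M N))) p.
    rewrite (metric_sym p).
    by move: (eps (maxn M N)) => e; lra.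
  exists p => //; apply/funext => n; apply: first_near_unique (hc p n) _.
  have [h1 h2] := zn n; split; first exact/(limit_nearP _ _ zp).
  by move=> k /h2 + /(limit_nearP _ _ zp).
Qed.

End PolishCode.

(** A nonempty dense set is needed to index the points, hence the separate
    treatment of the empty space. *)
Lemma polish_code (K : realType) (P : metricType K) : polish P ->
  exists c : P -> nat -> nat, [/\ injective c,
    <<s @open P >> = preimage_set_system setT c (borel (seqB nat)) &
    borel (seqB nat) (range c)].
Proof.
move=> [complete [D /countable_injP[f injf] dD]].
case: (pselect (exists p : P, True)) => [[p0 _]|noP].
  apply: (@dense_code K P (fun n => xget p0 [set p | D p /\ f p = n])) complete.
  move=> O O0 oO; have [x [Ox Dx]] := dD O O0 oO; exists x; split=> //.
  exists (f x) => //; case: xgetP => [y _ [Dy fy]|/(_ x)[]//].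
  by apply: injf => //; exact/mem_set.
have empty (U V : set P) : U = V.
  by apply/seteqP; split=> p; case: noP; exists p.
exists (fun=> fun=> 0%N); split.
- by move=> p; case: noP; exists p.
- apply/seteqP; split=> U _.
    by exists setT; [exact: (@borel_const (seqB nat) True)|exact: empty].
  by rewrite (empty U set0); exact: sigma_algebra0.
- rewrite (_ : range _ = set0); first exact: (@borel_const (seqB nat) False).
  by rewrite -subset0 => z [p]; case: (noP (ex_intro _ p I)).
Qed.

Lemma standard_borel_code (K : realType) (X : borelType) :
  standard_borel K X -> exists c : X -> nat -> nat, borel_code c.
Proof.
move=> [P [f [polP [g fK gK] bX]]].
have [c [injc oc rc]] := polish_code polP; exists (c \o f); split.
- exact: inj_comp injc (can_inj fK).
- rewrite bX oc; apply/seteqP; split=> U.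
    by move=> [_ [B bB <-] <-]; exists B => //; rewrite !setTI.
  by move=> [B bB <-]; exists (c @^-1` B);
    [exists B => //; rewrite setTI|rewrite setTI].
- rewrite (_ : range _ = range c)//; apply/seteqP; split=> z [x _ <-].
    by exists (f x).
  by exists (g x) => //=; rewrite gK.
Qed.

(** * Analytic sets and Lusin separation *)

(** The alphabet of the hidden coordinate is arbitrary, so that finite
    intersections can be formed by pairing the hidden coordinates. *)
Definition analytic (A : countType) (S : set (nat -> A)) : Prop :=
  exists (C : countType) (F : set (nat -> A * C)),
    closed_seq F /\ S = [set fst \o w | w in F].

Lemma closed_seq_preimage (A B : Type) (h : A -> B) (F : set (nat -> B)) :
  closed_seq F -> closed_seq [set w | F (h \o w)].
Proof.
move=> cF w wlim; apply: cF => n; have [w' Fw' ww'] := wlim n.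
by exists (h \o w') => // i /ww' /= ->.
Qed.

Lemma closed_seq_borel (A : countType) (F : set (nat -> A)) :
  closed_seq F -> borel (seqB A) F.
Proof.
move=> cF; apply: (@borel_ext (seqB A) [set z : nat -> A | forall n : nat,
    exists w : seq A, mkseq z (size w) = w /\
      [/\ size w = n & exists2 z', F z' & mkseq z' n = w]]).
  move=> z /=; split=> [h|Fz n]; last first.
    by exists (mkseq z n); rewrite size_mkseq; split=> //; split=> //; exists z.
  apply: cF => n; have [w [zw [wn [z' Fz' z'w]]]] := h n; exists z' => // i ni.
  have := congr1 (fun s => nth (z 0) s i) z'w.
  by rewrite -zw wn !nth_mkseq.
apply: borel_all => n; apply: borel_ex => w; apply: borel_and.
  exact: borel_prefix.
exact: borel_const.
Qed.

Section Analytic.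
Variable A : countType.
Implicit Types S : set (nat -> A).

Lemma analytic_borel S : borel (seqB A) S -> analytic S.
Proof.
move=> /borel_closed_lift[g [_ cl]]; exists nat; eexists; split;
  first exact: cl.
apply/seteqP; split=> [x Sx|_ [w [Sw _] <-]//].
by exists (fun n => (x n, g x n)).
Qed.

Lemma analytic_proj (C : countType) (H : set (nat -> A * C)) :
  borel (seqB (A * C)%type) H -> analytic [set fst \o w | w in H].
Proof.
move=> /borel_closed_lift[g [_ cl]].
pose assoc (a : A * (C * nat)) := ((a.1, a.2.1), a.2.2).
exists (C * nat)%type; eexists; split.
  exact: (closed_seq_preimage (h := assoc) cl).
apply/seteqP; split=> [_ [w Hw <-]|_ [w [Hw _] <-]].
  exists (fun n => ((w n).1, ((w n).2, g w n))) => //=.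
  rewrite /= (_ : fst \o _ = w); last first.
    by apply/funext => n /=; rewrite -surjective_pairing.
  by split.
by exists (fst \o (assoc \o w)).
Qed.

Lemma analytic_and S1 S2 :
  analytic S1 -> analytic S2 -> analytic [set x | S1 x /\ S2 x].
Proof.
move=> [C1 [F1 [cF1 ->]]] [C2 [F2 [cF2 ->]]].
pose p1 (a : A * (C1 * C2)) := (a.1, a.2.1).
pose p2 (a : A * (C1 * C2)) := (a.1, a.2.2).
exists (C1 * C2)%type, [set w | F1 (p1 \o w) /\ F2 (p2 \o w)]; split.
  move=> w wlim; split.
    apply: (closed_seq_preimage (h := p1) cF1) => n.
    by have [w' [Fw' _] ww'] := wlim n; exists w'.
  apply: (closed_seq_preimage (h := p2) cF2) => n.
  by have [w' [_ Fw'] ww'] := wlim n; exists w'.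
apply/seteqP; split=> [x [[w1 F1w ex1] [w2 F2w ex2]]|_ [w [F1w F2w] <-]].
  exists (fun n => (x n, ((w1 n).2, (w2 n).2))) => //; split.
    rewrite (_ : _ \o _ = w1)//; apply/funext => n.
    by rewrite /p1 /= -ex1 /= -surjective_pairing.
  rewrite (_ : _ \o _ = w2)//; apply/funext => n.
  by rewrite /p2 /= -ex2 /= -surjective_pairing.
by split; [exists (p1 \o w)|exists (p2 \o w)].
Qed.

Lemma analytic_all_in (I : eqType) (s : seq I) (S : I -> set (nat -> A)) :
  (forall i, analytic (S i)) -> analytic [set x | forall i, i \in s -> S i x].
Proof.
move=> aS; elim: s => [|i s IH].
  rewrite (_ : mkset _ = setT); last by apply/seteqP; split.
  by apply: analytic_borel; exact: (@borel_const (seqB A) True).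
rewrite (_ : mkset _ =
  [set x | S i x /\ [set x | forall j, j \in s -> S j x] x]).
  exact: analytic_and.
apply/seteqP; split=> x /= h.
  by split=> [|j js]; apply: h; rewrite inE ?eqxx ?js ?orbT.
by move=> j; rewrite inE => /predU1P[->|]; [exact: h.1|exact: h.2].
Qed.

End Analytic.

Lemma word_branch (T : Type) (Q : seq T -> Prop) :
  (forall w, (forall a, Q (rcons w a)) -> Q w) -> ~ Q [::] ->
  exists z : nat -> T, forall n, ~ Q (mkseq z n).
Proof.
move=> Qext Q0.
have /choice[f fP] (w : seq T) : exists v, ~ Q w -> ~ Q v /\ exists a,
  v = rcons w a.
  case: (pselect (exists a, ~ Q (rcons w a))) => [[a Qa]|h].
    by exists (rcons w a) => _; split=> //; exists a.
  exists w => Qw; case: Qw; apply: Qext => a; apply: contrapT => Qa.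
  by apply: h; exists a.
pose W n := iter n f [::].
have W_Q n : ~ Q (W n) by elim: n => // n IH; exact: (fP _ IH).1.
have /choice[z zP] n : exists a, W n.+1 = rcons (W n) a := (fP _ (W_Q n)).2.
exists z => n; rewrite (_ : mkseq z n = W n)//; elim: n => // n IH.
by rewrite mkseqS IH -zP.
Qed.

(** Lusin: if two analytic sets could not be separated, one could keep
    choosing pieces of them, of ever smaller diameter, that cannot be
    separated either; the limit points would be distinct, and small
    neighbourhoods of these are separated by a cylinder. *)
Lemma analytic_separation (A : countType) (S1 S2 : set (nat -> A)) :
  analytic S1 -> analytic S2 -> (forall x, S1 x -> S2 x -> False) ->
  exists B, [/\ borel (seqB A) B, S1 `<=` B & forall x, S2 x -> ~ B x].
Proof.
move=> [C1 [F1 [cF1 ->]]] [C2 [F2 [cF2 ->]]] disj.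
pose piece (C : Type) (F : set (nat -> A * C)) (w : seq (A * C)) :
  set (nat -> A) :=
  [set x | exists y, [/\ F y, mkseq y (size w) = w & fst \o y = x]].
pose sep (w : seq ((A * C1) * (A * C2))) := exists B, [/\ borel (seqB A) B,
  piece C1 F1 (map fst w) `<=` B & forall x, piece C2 F2 (map snd w) x ->
    ~ B x].
suff : sep [::].
  move=> [B [bB S1B S2B]]; exists B; split=> //.
    by move=> _ [y Fy <-]; apply: S1B; exists y.
  by move=> _ [y Fy <-]; apply: S2B; exists y.
apply: contrapT => /word_branch[|z zsep].
  move=> w /choice[B hB].
  exists [set x | exists p, forall q, B (p, q) x]; split.
  - by apply: borel_ex => p; apply: borel_all => q; case: (hB (p, q)).
  - move=> x [y [Fy yw yx]]; exists (y (size w)) => q.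
    case: (hB (y (size w), q)) => _ + _; apply; exists y; split=> //.
    by rewrite map_rcons size_rcons mkseqS yw size_map.
  - move=> x [y [Fy yw yx]] [p /(_ (y (size w)))].
    case: (hB (p, y (size w))) => _ _; apply; exists y; split=> //.
    by rewrite map_rcons size_rcons mkseqS yw size_map.
have map_mkseq' (T U : Type) (h : T -> U) (u : nat -> T) n :
  map h (mkseq u n) = mkseq (h \o u) n by rewrite /mkseq -map_comp.
have lim (C : Type) (F : set (nat -> A * C)) (y : nat -> A * C) : closed_seq F
  ->
    (forall n, exists x, piece C F (mkseq y n) x) -> F y.
  move=> cF h; apply: cF => n; have [_ [y' [Fy' yy' _]]] := h n.
  exists y' => // i ni; move: yy'; rewrite size_mkseq.
  by move=> /(congr1 (fun s => nth (y 0) s i)); rewrite !nth_mkseq.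
have F1z : F1 (fst \o z).
  apply: lim => // n; apply: contrapT => h; apply: (zsep n); exists set0; split.
  - exact: (@borel_const (seqB A) False).
  - by move=> x; rewrite map_mkseq' => px; apply: h; exists x.
  - by move=> x _ [].
have F2z : F2 (snd \o z).
  apply: lim => // n; apply: contrapT => h; apply: (zsep n); exists setT;
    split=> //.
  - exact: (@borel_const (seqB A) True).
  - by move=> x; rewrite map_mkseq' => px; case: h; exists x.
have [n xn] : exists n, (z n).1.1 <> (z n).2.1.
  apply: contrapT => h; apply: (disj (fst \o (fst \o z)));
    first by exists (fst \o z).
  exists (snd \o z) => //; apply/funext => n /=.
  by apply: contrapT => e; apply: h; exists n => e'; apply: e.
apply: (zsep n.+1); exists [set x | x n = (z n).1.1]; split.
- exact: borel_digit.
- move=> _ [y [_ + <-]]; rewrite map_mkseq' size_mkseq.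
  by move=> /(congr1 (fun s => nth (y 0) s n)); rewrite !nth_mkseq// => /= ->.
- move=> _ [y [_ + <-]]; rewrite map_mkseq' size_mkseq.
  move=> /(congr1 (fun s => nth (y 0) s n)); rewrite !nth_mkseq// => /= -> /=.
  by move=> e; apply: xn.
Qed.

(** For each [n], the sets of points over which the [n]-th digit of the value
    is [c] are disjoint analytic sets when [c] varies, hence they are contained
    in disjoint Borel sets; the latter define the digits of a Borel map. *)
Lemma analytic_graph_borel_map (A C : countType) (c0 : C)
    (H : (nat -> A) -> (nat -> C) -> Prop) :
  (forall n c, analytic [set x | exists y, H x y /\ y n = c]) ->
  (forall x y y', H x y -> H x y' -> y = y') ->
  exists phi : (nat -> A) -> nat -> C,
    @borel_map (seqB A) (seqB C) phi /\ forall x y, H x y -> y = phi x.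
Proof.
move=> aH uH; pose S n c := [set x | exists y, H x y /\ y n = c].
have /choice[B hB] (nc : nat * C * C) : exists B, [/\ borel (seqB A) B,
    nc.1.2 <> nc.2 -> S nc.1.1 nc.1.2 `<=` B &
    nc.1.2 <> nc.2 -> forall x, S nc.1.1 nc.2 x -> ~ B x].
  case: nc => [[n c] c'] /=; case: (pselect (c = c')) => [cc'|cc'].
    by exists setT; split=> //; exact: (@borel_const (seqB A) True).
  have [x [y [Hy e]] [y' [Hy' e']]|B [bB SB S'B]] :=
    analytic_separation (aH n c) (aH n c').
    by apply: cc'; rewrite -e -e' (uH _ _ _ Hy Hy').
  by exists B.
pose D n c := [set x | forall c', c <> c' -> B (n, c, c') x /\
  ~ B (n, c', c) x].
have bD n c : borel (seqB A) (D n c).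
  apply: borel_all => c'; apply: borel_imp; first exact: borel_const.
  apply: borel_and; last apply: borel_not.
    by case: (hB (n, c, c')).
  by case: (hB (n, c', c)).
have uD n c c' x : D n c x -> D n c' x -> c = c'.
  move=> Dc Dc'; apply: contrapT => cc'; have [h _] := Dc c' cc'.
  by have [_] := Dc' c (nesym cc').
have SD n c : S n c `<=` D n c.
  move=> x Sx c' cc'; case: (hB (n, c, c')) => _ /(_ cc') + _ => /(_ x Sx) ?.
  by split=> //; case: (hB (n, c', c)) => _ _ /(_ (nesym cc')); exact.
exists (fun x n => xget c0 [set c | D n c x]); split.
  apply: borel_map_seq => n c.
  apply: (@borel_ext (seqB A)
    [set x | D n c x \/ c = c0 /\ forall c', ~ D n c' x]).
    move=> x /=; split.
      case=> [Dc|[-> nD]]; case: xgetP => [c' _ Dc'|nD']//.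
      - exact: uD Dc' Dc.
      - by case: (nD' c).
      - by case: (nD c').
    by case: xgetP => [c' -> Dc' <-|nD <-]; [left|right].
  apply: borel_or; first exact: bD.
  apply: borel_and; first exact: borel_const.
  by apply: borel_all => c'; apply: borel_not; exact: bD.
move=> x y Hxy; apply/funext => n.
have Dy : D n (y n) x by apply: SD; exists y.
by case: xgetP => [c _ Dc|/(_ (y n))//]; exact: uD Dy Dc.
Qed.

(** * Borel sets with countable sections *)

Lemma powerset_nat_uncountable (e : (nat -> bool) -> nat) : ~ injective e.
Proof.
move=> inje.
pose a n := `[< exists b, e b = n /\ b n = false >].
case E : (a (e a)).
  have [b [/inje -> ]] := asboolW E; by rewrite E.
have /asboolPn : ~~ a (e a) by rewrite E.
by apply; exists a.
Qed.

Definition pair_seq (A C : Type) (x : nat -> A) (y : nat -> C) n := (x n, y n).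

Section CountableSections.
Variables (A C : countType) (c0 : C) (F : set (nat -> A * C)).
Hypothesis closedF : closed_seq F.

Local Notation word := (seq (A * C)).
Local Notation borelF := (@borel_map (seqB A) (seqB C)).

Let pair_seqE (u : nat -> A * C) : pair_seq (fst \o u) (snd \o u) = u.
Proof. by apply/funext => n; rewrite /pair_seq /= -surjective_pairing. Qed.

Let escapes (Phi : nat -> (nat -> A) -> nat -> C) (w : word) (x : nat -> A) :=
  exists y, [/\ F (pair_seq x y), mkseq (pair_seq x y) (size w) = w &
                forall k, y <> Phi k x].

(** Smallness concerns a whole family, because the parts of [F] in its cylinders
    have to be split further over one and the same point of the base. *)
Let small (L : seq word) := exists Phi, (forall k, borelF (Phi k)) /\
  forall x, ~ forall w, w \in L -> escapes Phi w x.

Let small_sub (L L' : seq word) : {subset L <= L'} -> small L -> small L'.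
Proof.
move=> LL' [Phi [bPhi h]]; exists Phi; split=> // x h'.
by apply: (h x) => w /LL'; exact: h'.
Qed.

Let escapes_sub Phi Psi w x :
  (forall k, exists l, Phi k = Psi l) -> escapes Psi w x -> escapes Phi w x.
Proof.
by move=> sub [y [Fy yw ny]]; exists y; split=> // k; have [l ->] := sub k.
Qed.

Let merge (I : countType) (P : I -> (nat -> (nat -> A) -> nat -> C) -> Prop) :
  (forall i, exists Phi : nat -> (nat -> A) -> nat -> C,
    (forall k, borelF (Phi k)) /\ P i Phi) ->
  exists Psi : nat -> (nat -> A) -> nat -> C, (forall k, borelF (Psi k)) /\
    forall i, exists2 Phi, P i Phi & forall k, exists l, Phi k = Psi l.
Proof.
move=> /choice[Phi hPhi].
exists (fun l => if @unpickle (I * nat)%type l is Some p then Phi p.1 p.2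
                 else fun=> fun=> c0); split.
  move=> l; case: unpickle => [[i k]|] /=; first exact: (hPhi i).1.
  exact: borel_map_cst.
move=> i; exists (Phi i); first exact: (hPhi i).2.
by move=> k; exists (pickle (i, k)); rewrite pickleK.
Qed.

Let prefix_of (w w1 : word) := exists v, w1 = w ++ v.

Let differ (w1 w2 : word) := exists i a1 a2, [/\ onth w1 i = Some a1,
  onth w2 i = Some a2 & a1.2 <> a2.2].

Let differ_size w w1 w2 : prefix_of w w1 -> prefix_of w w2 -> differ w1 w2 ->
  size w < size w1 /\ size w < size w2.
Proof.
move=> [v1 e1] [v2 e2] [i [a1 [a2 [w1i w2i a12]]]].
have iw : size w <= i.
  rewrite leqNgt; apply/negP => iw; move: w1i w2i; rewrite e1 e2 !onth_cat iw.
  by move=> -> [a1a2]; apply: a12; rewrite a1a2.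
by split; apply: leq_ltn_trans iw _; rewrite -onthTE ?w1i ?w2i.
Qed.

Let cylinder_size (u : nat -> A * C) n :
  mkseq u (size (mkseq u n)) = mkseq u n.
Proof. by rewrite size_mkseq. Qed.

Let onth_mkseq (T : Type) (u : nat -> T) n i : i < n ->
  onth (mkseq u n) i = Some (u i).
Proof.
by move=> ni; rewrite onthE (nth_map (u 0)) ?size_mkseq// nth_mkseq.
Qed.

(** If all such pairs of extensions gave small families, then, off countably
    many Borel graphs, the part of [F] in the cylinder [w] that lies over the
    points where the words of [L] escape would have at most one point in each
    fibre, hence be covered by one more Borel graph. *)
Let split_word w L : ~ small (w :: L) -> exists w1 w2,
  [/\ ~ small [:: w1, w2 & L], prefix_of w w1, prefix_of w w2 & differ w1 w2].
Proof.
move=> nsm; apply: contrapT => nsplit; apply: nsm.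
have [|Psi [bPsi hPsi]] := @merge (word * word)%type (fun ww Phi =>
   prefix_of w ww.1 -> prefix_of w ww.2 -> differ ww.1 ww.2 ->
   forall x, ~ forall v, v \in [:: ww.1, ww.2 & L] -> escapes Phi v x).
  move=> [w1 w2] /=; case: (pselect (small [:: w1, w2 & L])).
    by move=> [Phi [bPhi h]]; exists Phi.
  move=> nsm; exists (fun=> fun=> fun=> c0); split.
    by move=> k; exact: borel_map_cst.
  by move=> ww1 ww2 d12; case: nsplit; exists w1, w2.
pose H x y := [/\ F (pair_seq x y), mkseq (pair_seq x y) (size w) = w,
  forall k, y <> Psi k x & forall v, v \in L -> escapes Psi v x].
have aEsc (v : word) n (P : C -> Prop) :
  analytic [set x | exists y, [/\ F (pair_seq x y),
    mkseq (pair_seq x y) (size v) = v, forall k, y <> Psi k x & P (y n)]].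
  rewrite (_ : mkset _ = [set fst \o u | u in [set u : nat -> A * C |
    F u /\ (mkseq u (size v) = v /\ ((forall k, snd \o u <> Psi k (fst \o u)) /\
    P (u n).2))]]).
    apply: analytic_proj; apply: borel_and; first exact: closed_seq_borel.
    apply: borel_and; first exact: borel_prefix.
    have bfst : @borel_map (seqB (A * C)%type) (seqB A) (fun u => fst \o u).
      exact: (@borel_map_digits (seqB (A * C)%type) _ A id (fun=> fst) id).
    apply: borel_and.
      apply: borel_all => k; apply: borel_not; apply: borel_seq_eq.
        exact: (@borel_map_digits (seqB (A * C)%type) _ C id (fun=> snd) id).
      exact: (borel_map_comp (bPsi k) bfst).
    exact: (@borel_digit_in (seqB (A * C)%type) _ id n (fun a => P a.2)).
  apply/seteqP; split=> [x [y [Fy yv ny Py]]|_ [u [Fu [uv [nu Pu]]] <-]].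
    by exists (pair_seq x y).
  by exists (snd \o u); rewrite pair_seqE; split.
have [||phi [bphi Hphi]] := @analytic_graph_borel_map A C c0 H.
- move=> n c.
  rewrite (_ : mkset _ = [set x | [set x | exists y, [/\ F (pair_seq x y),
    mkseq (pair_seq x y) (size w) = w, forall k, y <> Psi k x & y n = c]] x /\
    [set x | forall v, v \in L -> escapes Psi v x] x]).
    apply: analytic_and; first exact: (aEsc w n (fun b => b = c)).
    apply: analytic_all_in => v.
    rewrite (_ : escapes Psi v = [set x | exists y, [/\ F (pair_seq x y),
      mkseq (pair_seq x y) (size v) = v, forall k,
        y <> Psi k x & (fun=> True) (y 0)]]).
      exact: (aEsc v 0 (fun=> True)).
    by apply/seteqP; split=> x [y]; [move=> [? ? ?]|move=> [? ? ? _]]; exists y.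
  apply/seteqP; split=> x; first by move=> [y [[? ? ? ?] ?]]; split=> //;
    exists y.
  by move=> [[y [? ? ? ?]] ?]; exists y.
- move=> x y y' [Fy yw ny HL] [Fy' yw' ny' _]; apply: contrapT => yy'.
  have [n yn] : exists n, y n <> y' n.
    apply: contrapT => h; apply: yy'; apply/funext => n.
    by apply: contrapT => e; apply: h; exists n.
  pose N := size w + n.+1.
  have pre (u : nat -> C) : mkseq (pair_seq x u) (size w) = w ->
      prefix_of w (mkseq (pair_seq x u) N).
    move=> uw; exists (mkseq (fun i => pair_seq x u (size w + i)) n.+1).
    rewrite -{1}uw /mkseq /N iotaD map_cat add0n; congr (_ ++ _).
    by rewrite -{1}[size w]addn0 iotaDl -map_comp.
  have [Phi hPhi sub] := hPsi (mkseq (pair_seq x y) N, mkseq (pair_seq x y') N).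
  have nN : n < N by rewrite /N addnS ltnS leq_addl.
  have [|||//] := hPhi _ _ _ x.
  + exact: pre.
  + exact: pre.
  + by exists n, (x n, y n), (x n, y' n); rewrite !onth_mkseq.
  move=> v; rewrite !inE => /or3P[/eqP ->|/eqP ->|/HL]; apply: escapes_sub =>
    //.
    by exists y; rewrite cylinder_size.
  by exists y'; rewrite cylinder_size.
exists (fun k => if k is k'.+1 then Psi k' else phi); split; first by case.
move=> x h; have [y [Fy yw ny]] := h w (mem_head _ _).
apply: (ny 0); apply: Hphi; split=> // [k|v vL]; first exact: (ny k.+1).
have := h v; rewrite inE vL orbT => /(_ isT); apply: escapes_sub => k.
by exists k.+1.
Qed.

(** The words of a level of the binary tree are listed in such a way that the
    children of the word of index [i] have indices [2i] and [2i+1]. *)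
Let splits (L L' : seq word) := size L' = (size L).*2 /\
  forall i, i < size L -> [/\ differ (nth [::] L' i.*2) (nth [::] L' i.*2.+1),
    prefix_of (nth [::] L i) (nth [::] L' i.*2) &
    prefix_of (nth [::] L i) (nth [::] L' i.*2.+1)].

Let split_all L : ~ small L -> exists L', splits L L' /\ ~ small L'.
Proof.
suff gen M : ~ small (L ++ M) -> exists L', splits L L' /\ ~ small (L' ++ M).
  move=> nsm; have [|L'] := gen [::]; first by rewrite cats0.
  by rewrite cats0; exists L'.
elim: L M => [|w L IH] M nsm; first by exists [::].
have [w1 [w2 [nsm12 p1 p2 d12]]] := split_word nsm.
have [|L' [[sL' hL'] nsm']] := IH [:: w1, w2 & M].
  by apply: contra_not nsm12; apply: small_sub => v; rewrite !(inE, mem_cat);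
    do ?case: (_ == _); rewrite ?orbT //= ?orbF.
exists [:: w1, w2 & L']; split.
  by split=> [|[|i] //= iL]; rewrite /= ?sL'//; exact: hL'.
apply: contra_not nsm'; apply: small_sub => v; rewrite !(inE, mem_cat).
by do ?case: (_ == _); rewrite ?orbT //= ?orbF.
Qed.

(** Repeated splitting of a family that is not small would produce a binary
    tree of words, all of whose branches define points of [F] over one and the
    same point, and these points are distinct. *)
Let small_root : (forall x, countable [set y | F (pair_seq x y)]) ->
  small [:: [::]].
Proof.
move=> countF; apply: contrapT => nsm0.
pose L0 : {L | ~ small L} := exist (fun L => ~ small L) _ nsm0.
have /choice[next nextP] (L : {L | ~ small L}) :
    exists L' : {L | ~ small L}, splits (sval L) (sval L').
  by have [L' [sp nsm]] := split_all (svalP L);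
    exists (exist (fun L => ~ small L) L' nsm).
pose T n := sval (iter n next L0).
have Tsplit n : splits (T n) (T n.+1) by exact: nextP.
have sizeT n : size (T n) = 2 ^ n.
  by elim: n => // n IH; rewrite (Tsplit n).1 IH expnS mul2n.
(* The position at level [n] of the branch that follows the bits of [al]. *)
pose idx (al : nat -> bool) n := iteri n (fun i k => k.*2 + al i) 0.
have idx_lt al n : idx al n < 2 ^ n.
  elim: n => // n IH; rewrite /= expnS mul2n.
  by case: (al n); rewrite ?addn1 ?addn0 ?ltn_double// ltn_Sdouble.
pose W al n := nth [::] (T n) (idx al n).
have W_pre al n : prefix_of (W al n) (W al n.+1).
  have [] := (Tsplit n).2 (idx al n); first by rewrite sizeT.
  by rewrite /W /=; case: (al n); rewrite ?addn1 ?addn0.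
have W_differ al be n : (forall i, i < n -> al i = be i) -> al n <> be n ->
    differ (W al n.+1) (W be n.+1).
  move=> agree nagree; have idxE : idx al n = idx be n.
    elim: n agree {nagree} => //= n IH h; rewrite h// IH// => i ni.
    by rewrite h// ltnW.
  have [] := (Tsplit n).2 (idx al n); first by rewrite sizeT.
  rewrite /W /= -idxE; case: (al n) (be n) nagree => -[]//;
    rewrite ?addn1 ?addn0 // => _ d _ _.
  by have [i [a1 [a2 [? ? /nesym ?]]]] := d; exists i, a2, a1.
have W_leq al m n : m <= n -> prefix_of (W al m) (W al n).
  elim: n => [|n IH]; first by rewrite leqn0 => /eqP ->; exists [::];
    rewrite cats0.
  rewrite leq_eqVlt => /predU1P[->|]; first by exists [::]; rewrite cats0.
  rewrite ltnS => /IH[v e]; have [v' e'] := W_pre al n.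
  by exists (v ++ v'); rewrite catA -e.
have W_size al n : n <= size (W al n).
  elim: n => // n IH; apply: leq_ltn_trans IH _.
  have [] := (Tsplit n).2 (idx al n); first by rewrite sizeT.
  move=> d p1 p2; have [] := differ_size p1 p2 d.
  by rewrite /W /=; case: (al n); rewrite ?addn1 ?addn0.
have /choice[x xP] n : exists x, forall w, w \in T n ->
    exists2 y, F (pair_seq x y) & mkseq (pair_seq x y) (size w) = w.
  apply: contrapT => h; apply: (svalP (iter n next L0)).
  exists (fun=> fun=> fun=> c0); split; first by move=> k; exact: borel_map_cst.
  move=> x hx; apply: h; exists x => w /hx[y [Fy yw _]]; by exists y.
pose u al n := nth (x 0 0, c0) (W al n.+1) n.
have W_u al n : W al n = mkseq (u al) (size (W al n)).
  apply: (@eq_from_nth _ (x 0 0, c0)); rewrite ?size_mkseq// => i iW.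
  rewrite nth_mkseq// /u.
  have [v e] := W_leq al _ _ (leq_maxl n i.+1).
  have [v' e'] := W_leq al _ _ (leq_maxr n i.+1).
  have := congr1 (fun s => nth (x 0 0, c0) s i) (etrans (esym e) e').
  by rewrite !nth_cat iW (leq_trans _ (W_size al i.+1)).
have W_in al n : W al n \in T n by apply: mem_nth; rewrite sizeT.
have Fu al : F (u al).
  apply: closedF => n; have [y Fy yw] := xP n _ (W_in al n).
  exists (pair_seq (x n) y) => // i ni.
  have iW : i < size (W al n) by exact: leq_trans ni (W_size al n).
  have := congr1 (fun s => nth (x 0 0, c0) s i) yw.
  by rewrite {2}W_u !nth_mkseq.
(* The words of one level are compatible in their first coordinate, as they
   all meet the fibre of [F] over [x n]; hence the first coordinate of a
   branch does not depend on the branch. *)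
have fst_u al : fst \o u al = fun n => x n.+1 n.
  apply/funext => n /=; have [y Fy yw] := xP n.+1 _ (W_in al n.+1).
  by rewrite /u -yw nth_mkseq//; exact: W_size.
have u_inj al be : snd \o u al = snd \o u be -> al = be.
  move=> e; apply: contrapT => ab.
  have ex : exists n, al n != be n.
    apply: contrapT => h; apply: ab; apply/funext => n.
    by apply/eqP; apply: contrapT => /negP ne; apply: h; exists n.
  case: (ex_minnP ex) => n /eqP abn nmin.
  have [|i [a1 [a2 [h1 h2]]]] := W_differ al be n _ abn.
    move=> i ni; apply/eqP; apply: contrapT => /negP /nmin.
    by rewrite leqNgt ni.
  move: h1 h2; rewrite W_u [W be _]W_u.
  have lt_onth (T' : Type) (s : seq T') b : onth s i = Some b -> i < size s.
    by move=> h; rewrite -onthTE h.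
  move=> h1 h2; have := lt_onth _ _ _ h1; have := lt_onth _ _ _ h2.
  rewrite !size_mkseq => i2 i1; move: h1 h2; rewrite !onth_mkseq// =>
    -[<-] [<-].
  by apply; exact: (congr1 (fun f => f i) e).
have Fx al : F (pair_seq (fun n => x n.+1 n) (snd \o u al)).
  by rewrite -(fst_u al) pair_seqE.
have /countable_injP[f injf] := countF (fun n => x n.+1 n).
apply: (@powerset_nat_uncountable (fun al => f (snd \o u al))) => al be fab.
by apply: u_inj; apply: injf fab; apply/mem_set; exact: Fx.
Qed.

Lemma closed_countable_sections :
  (forall x, countable [set y | F (pair_seq x y)]) ->
  exists Phi : nat -> (nat -> A) -> nat -> C, (forall k, borelF (Phi k)) /\
    forall x y, F (pair_seq x y) -> exists k, y = Phi k x.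
Proof.
move=> /small_root[Phi [bPhi h]]; exists Phi; split=> // x y Fxy.
apply: contrapT => ny; apply: (h x) => w; rewrite inE => /eqP ->.
by exists y; split=> // k yk; apply: ny; exists k.
Qed.

End CountableSections.

(** * Countable Borel equivalence relations *)

Lemma borel_code_map (X : borelType) (A : countType) (c : X -> nat -> A) :
  borel_code c -> @borel_map X (seqB A) c.
Proof. by move=> [_ bX _] B bB; rewrite bX; exact: borel_map_pullback. Qed.

Lemma borel_code_to (X Y : borelType) (A : countType) (c : Y -> nat -> A)
    (f : X -> Y) :
  borel_code c -> @borel_map X (seqB A) (fun x => c (f x)) -> borel_map f.
Proof.
move=> [_ bY _] bcf B; rewrite bY => -[D bD <-]; rewrite setTI.
exact: bcf _ bD.
Qed.

Lemma borel_code_eq (X Y : borelType) (A : countType) (c : Y -> nat -> A)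
    (f g : X -> Y) :
  borel_code c -> borel_map f -> borel_map g -> borel X [set x | f x = g x].
Proof.
move=> cc bf bg; have bc := borel_code_map cc; case: cc => injc _ _.
apply: (@borel_ext _ [set x | c (f x) = c (g x)]).
  by move=> x; split=> [/injc|/= ->].
by apply: borel_seq_eq; exact: borel_map_comp bc _.
Qed.

Lemma borel_code_prod (X Y : borelType) (A B : countType) (c : X -> nat -> A)
    (d : Y -> nat -> B) : borel_code c -> borel_code d ->
  @borel_code (prodB X Y) (A * B)%type (fun p n => (c p.1 n, d p.2 n)).
Proof.
move=> cc cd; have bc := borel_code_map cc; have bd := borel_code_map cd.
have bfst : @borel_map (seqB (A * B)%type) (seqB A) (fun w => fst \o w).
  exact: (@borel_map_digits (seqB (A * B)%type) _ A id (fun=> fst) id).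
have bsnd : @borel_map (seqB (A * B)%type) (seqB B) (fun w => snd \o w).
  exact: (@borel_map_digits (seqB (A * B)%type) _ B id (fun=> snd) id).
case: cc cd => injc bX rc [injd bY rd].
set j := fun p => _; have bj : @borel_map (prodB X Y) (seqB (A * B)%type) j.
  apply: borel_map_seq => n [a b].
  apply: (@borel_ext (prodB X Y) [set p : X * Y | c p.1 n = a /\ d p.2 n = b]).
    by move=> p; split=> [[<- <-]|[<- <-]].
  apply: borel_and.
    exact: (borel_map_comp bc (@borel_map_fst X Y)) _ (borel_digit n a).
  exact: (borel_map_comp bd (@borel_map_snd X Y)) _ (borel_digit n b).
split.
- move=> [x y] [x' y'] e; congr (_, _).
    by apply: injc; apply/funext => n; have := congr1 (fun f => (f n).1) e.
  by apply: injd; apply/funext => n; have := congr1 (fun f => (f n).2) e.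
- apply/seteqP; split=> U; last by move=> [D bD <-]; rewrite setTI; exact: bj.
  pose Pj := @pullbackB (seqB (A * B)%type) (X * Y)%type j.
  have bid : @borel_map Pj (prodB X Y) (fun p => (p.1, p.2)).
    apply: borel_map_pair => D.
      rewrite bX => -[D' bD' <-].
      by exists [set w | D' (fst \o w)]; [exact: bfst|rewrite !setTI].
    rewrite bY => -[D' bD' <-].
    by exists [set w | D' (snd \o w)]; [exact: bsnd|rewrite !setTI].
  by move=> /bid /borel_ext; apply => -[].
- apply: (@borel_ext (seqB (A * B)%type) [set w : nat -> A * B |
      range c (fst \o w) /\ range d (snd \o w)]).
    move=> w; split=> [[[x _ ex] [y _ ey]]|[[x y] _ <-]].
      exists (x, y) => //; apply/funext => n; rewrite /j /= ex ey /=.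
      by rewrite -surjective_pairing.
    by split; [exists x|exists y].
  by apply: borel_and; [exact: (bfst _ rc)|exact: (bsnd _ rd)].
Qed.

Lemma borel_code_id (A : countType) : @borel_code (seqB A) A id.
Proof.
split=> //.
- apply/seteqP; split=> D; first by exists D; rewrite ?setTI.
  by move=> [D' bD' <-]; rewrite setTI.
- apply: (borel_ext _ (@borel_const (seqB A) True)) => z.
  by split=> // _; exists z.
Qed.

Lemma borel_code_sub (X W : borelType) (A : countType) (c : X -> nat -> A)
    (i : W -> X) :
  borel_code c -> injective i -> borel W = borel (pullbackB i) ->
  borel X (range i) -> borel_code (fun w => c (i w)).
Proof.
move=> [injc bX rc] inji bW ri; split.
- by move=> w w' /injc/inji.
- rewrite bW; apply/seteqP; split=> U.
    move=> [B + <-]; rewrite bX => -[D bD <-].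
    by exists D => //; rewrite !setTI.
  move=> [D bD <-]; exists (c @^-1` D); last by rewrite !setTI.
  by rewrite bX; exists D => //; rewrite setTI.
- move: ri; rewrite bX => -[D bD]; rewrite setTI => Dri.
  apply: (@borel_ext (seqB A) [set z : nat -> A | D z /\ range c z]).
    move=> z; split=> [[Dz [x _ xz]]|[w _ <-]].
      by move: Dz; rewrite -xz -[D _]/((c @^-1` D) x) Dri => -[w _ <-];
        exists w.
    split; last by exists (i w).
    by rewrite -[D _]/((c @^-1` D) (i w)) Dri; exists w.
  exact: borel_and.
Qed.

(** Lusin and Novikov.  The relation is replaced by its closed lift, which has
    countable sections as well, and the maps obtained there are corrected to be
    the identity where their values do not lie in the relation; this is where
    reflexivity is used. *)
Lemma borel_enumeration (X : borelType) (c : X -> nat -> nat)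
    (R : X * X -> Prop) : borel_code c ->
  borel (prodB X X) R -> (forall x, R (x, x)) ->
  (forall x, countable [set y | R (x, y)]) ->
  exists f : nat -> X -> X, (forall k, borel_map (f k)) /\
    forall x y, R (x, y) <-> exists k, y = f k x.
Proof.
move=> cc bR Rxx Rcount; have bc := borel_code_map cc.
pose j (p : X * X) n := (c p.1 n, c p.2 n).
pose D : set (nat -> nat * nat) := [set j p | p in R].
have injc : injective c by case: cc.
have injj : injective j by case: (borel_code_prod cc cc).
have DR p : D (j p) <-> R p.
  by split=> [[q Rq /injj <-]|Rp]//; exists p.
have bD : borel (seqB (nat * nat)%type) D.
  have [_ bXX rj] := borel_code_prod cc cc.
  move: bR; rewrite bXX => -[D' bD']; rewrite setTI => D'R.
  apply: (@borel_ext (seqB (nat * nat)%type) [set w : nat -> nat * nat |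
    D' w /\ range j w]); last exact: borel_and.
  move=> w; split=> [[D'w [p _ pw]]|[p Rp <-]].
    by exists p => //; rewrite -D'R /preimage /= -/(j p) pw.
  by split; [move: Rp; rewrite -D'R|exists p].
have [g [_ clg]] := borel_closed_lift bD.
pose assoc (a : nat * (nat * nat)) := ((a.1, a.2.1), a.2.2).
have := closed_seq_preimage (h := assoc) clg; set F := [set w | _] => clF.
have FP z y : F (fun n => (z n, y n)) <->
    D (fun n => (z n, (y n).1)) /\ snd \o y = g (fun n => (z n, (y n).1)) by [].
have [|Phi [bPhi PhiF]] := @closed_countable_sections _ _ (0, 0) F clF.
  move=> z; case: (pselect (exists x, c x = z)) => [[x <-]|nz]; last first.
    rewrite (_ : mkset _ = set0); first exact: countable0.
    rewrite -subset0 => y /FP[[[x y'] _ e] _]; apply: nz; exists x.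
    by apply/funext => n; have := congr1 (fun f => (f n).1) e.
  pose h (y : X) n := (c y n, g (j (x, y)) n).
  have : countable (h @` [set y | R (x, y)]).
    exact: sub_countable (card_image_le _ _) (Rcount x).
  apply: sub_countable; apply: subset_card_le => u /FP[[[x' y] Rxy e] gu].
  have e1 : x' = x.
    by apply: injc; apply/funext => n; have := congr1 (fun f => (f n).1) e.
  subst x'; exists y => //.
  apply/funext => n; rewrite /h [u n]surjective_pairing; congr (_, _).
    by have := congr1 (fun f => (f n).2) e.
  by rewrite e; have := congr1 (fun f => f n) gu.
pose psi k x := fst \o Phi k (c x).
pose good k x := D (fun n => (c x n, psi k x n)).
have bpsi k : @borel_map X (seqB nat) (psi k).
  by apply: (@borel_map_digits X (nat * nat)%type nat (fun x => Phi k (c x))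
    (fun=> fst) id); exact: (borel_map_comp (bPhi k) bc).
have bgood k : borel X [set x | good k x].
  apply: (borel_preimage _ bD); apply: borel_map_seq => n [a b].
  apply: (@borel_ext _ [set x | c x n = a /\ psi k x n = b]).
    by move=> x; split=> [[<- <-]|[<- <-]].
  by apply: borel_and; [exact: (bc _ (borel_digit n a))|exact:
    (bpsi k _ (borel_digit n b))].
have ex k x : exists y, (good k x -> R (x, y) /\ c y = psi k x) /\
    (~ good k x -> y = x).
  case: (pselect (good k x)) => [gx|]; last by exists x.
  case: (gx) => -[x' y] Rxy e; exists y; split=> // _; split.
    rewrite (_ : x = x')//; apply: injc; apply/funext => n.
    by have := congr1 (fun f => (f n).1) e.
  by apply/funext => n; have := congr1 (fun f => (f n).2) e.
have /choice[f fP] k : exists h : X -> X, forall x,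
    (good k x -> R (x, h x) /\ c (h x) = psi k x) /\ (~ good k x -> h x = x).
  by have [h hP] := choice (ex k); exists h.
exists f; split=> [k|x y].
  apply: (borel_code_to cc) => B bB.
  apply: (@borel_ext _ [set x | good k x /\ B (psi k x) \/ ~ good k x /\
    B (c x)]).
    move=> x; split=> [[[gx Bx]|[ngx Bx]]|/=].
    - by rewrite /= ((fP k x).1 gx).2.
    - by rewrite /= ((fP k x).2 ngx).
    - case: (pselect (good k x)) => gx; first by rewrite ((fP k x).1 gx).2;
      left.
      by rewrite ((fP k x).2 gx); right.
  apply: borel_or; apply: borel_and;
    [exact: bgood|exact: (bpsi k _ bB)| |exact: (bc _ bB)].
  by apply: borel_not; exact: bgood.
split=> [Rxy|[k ->]]; last first.
  case: (pselect (good k x)) => gx; first exact: ((fP k x).1 gx).1.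
  by rewrite ((fP k x).2 gx).
have [|k ek] := PhiF (c x) (fun n => (c y n, g (j (x, y)) n)).
  by apply/FP; split=> //; exists (x, y).
exists k; have psiE : psi k x = c y by apply/funext => n; rewrite /psi -ek.
have gx : good k x by rewrite /good psiE; exists (x, y).
by apply: injc; rewrite ((fP k x).1 gx).2.
Qed.

(** * Orientations of trees *)

Section Links.
Variable X : Type.
Implicit Types (T : set (X * X)) (a b c v : X).

Fixpoint chain T n a b : Prop :=
  if n is n'.+1 then exists c, (T (a, c) \/ T (c, a)) /\ chain T n' c b
  else a = b.

Definition linked T a b := exists n, chain T n a b.

Lemma linked_refl T a : linked T a a.
Proof. by exists 0. Qed.

Lemma linked_step T a c b : T (a, c) \/ T (c, a) -> linked T c b ->
  linked T a b.
Proof. by move=> Tac [n cb]; exists n.+1, c. Qed.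

Lemma linked_trans T a b c : linked T a b -> linked T b c -> linked T a c.
Proof.
move=> [n]; elim: n a => [a <-//|n IH a [d [Tad db]] bc].
exact: linked_step Tad (IH _ db bc).
Qed.

Lemma linked_sym T a b : linked T a b -> linked T b a.
Proof.
move=> [n]; elim: n a => [a <-|n IH a [d [Tad /IH bd]]];
  first exact: linked_refl.
by apply: linked_trans bd (linked_step _ (linked_refl T a)); case: Tad; tauto.
Qed.

Lemma linked_sub T T' a b : T `<=` T' -> linked T a b -> linked T' a b.
Proof.
move=> TT' [n]; elim: n a => [a <-|n IH a [d [Tad /IH]]];
  first exact: linked_refl.
by apply: linked_step; case: Tad => /TT'; [left|right].
Qed.

(** For an edge [k] of a tree, this says that [k], which runs from [k.2] to
    [k.1], points towards [v]. *)
Definition toward T (k : X * X) v := linked (T `\ k) v k.1.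

End Links.

Section Reduction.
Variable G : graph.

Fixpoint all_edges (P : edge G -> Prop) (p : seq (edge G * bool)) : Prop :=
  if p is a :: q then P a.1 /\ all_edges P q else True.

(** Cancelling backtrackings turns a walk into a reduced one. *)
Lemma walk_reduce P (v w : vertex G) p : walk v p w -> all_edges P p ->
  exists q, [/\ walk v q w, reduced q & all_edges P q].
Proof.
elim: p v => [|a p IH] v /=; first by move=> vw _; exists [::].
move=> [-> /IH h] [Pa /h[q [wq rq Pq]]].
case: q wq rq Pq => [|b q] wq rq Pq; first by exists [:: a].
case: (pselect (a.1 = b.1 /\ a.2 = ~~ b.2)) => [[ab1 ab2]|nab].
  exists q; split; [|by case: rq|by case: Pq].
  suff -> : osrc a = orng b by case: wq.
  by rewrite /osrc /orng ab1 ab2; case: b.2.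
by exists [:: a, b & q].
Qed.

End Reduction.

Section Treeing.
Variables (X : borelType) (S : borelEquiv X) (T : set (X * X)).
Hypothesis treeingT : treeing S T.

Lemma treeing_linked x y : S (x, y) <-> linked T x y.
Proof.
have [_ _ /(_ x)[comp _]] := treeingT.
rewrite -[S (x, y)]/(class_of S x y) -comp; split.
  move=> [p]; elim: p x {comp} => [|[k s] p IH] x /=; first by move=> ->;
    exact: linked_refl.
  move=> [-> /IH]; apply: linked_step; have := set_valP k.
  by rewrite /osrc /orng /=; case: s; case: (val k) => a b /=; [right|left].
move=> [n]; elim: n x {comp} => [x ->|n IH x [c [Txc /IH[p wp]]]].
  by exists [::].
case: Txc => Tk.
  by exists ((SigSub (mem_set Tk), false) :: p).
by exists ((SigSub (mem_set Tk), true) :: p).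
Qed.

Lemma treeing_class_countable x : countable (class_of S x).
Proof.
have [_ _ /(_ x)[_ [+ _ _ _]]] := treeingT.
move=> /(sub_countable (card_image_le (fun y : class_of S x => val y) _)).
apply: sub_countable; apply: subset_card_le => y Sxy.
by exists (SigSub (mem_set Sxy)).
Qed.

(** A reduced walk between the endpoints that avoids the edge would close up
    with it to a circuit. *)
Lemma edge_separates k : T k -> ~ linked (T `\ k) k.1 k.2.
Proof.
move=> Tk [n]; have [_ TS /(_ k.1)[_ [_ _ _ acyc]]] := treeingT.
set A := class_of S k.1 in acyc; set G := Defs.induced _ in acyc.
have A1 : A k.1 by exact: Defs.equiv_refl.
have A2 : A k.2 by apply: TS; rewrite -surjective_pairing.
have edgeA (e : X * X) : T e -> A e.1 \/ A e.2 -> A e.1 /\ A e.2.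
  move=> /TS; rewrite [e]surjective_pairing /= => Se [] Ae; split=> //.
    exact: Defs.equiv_trans Ae Se.
  exact: Defs.equiv_trans Ae (Defs.equiv_sym Se).
pose mkE (e : X * X) (Te : T e) (Ae : A e.1 /\ A e.2) : edge G :=
  SigSub (mem_set (conj Ae.2 Ae.1 : [set e : edge (graph_of T) |
    A (src e) /\ A (rng e)] (SigSub (mem_set Te)))).
have walks m : forall a b (Aa : A a) (Ab : A b), chain (T `\ k) m a b ->
    exists p, @walk G (SigSub (mem_set Aa)) p (SigSub (mem_set Ab)) /\
    all_edges (fun e : edge G => val (val e) <> k) p.
  elim: m => [a b Aa Ab ab|m IH a b Aa Ab [d [Tad db]]].
    by exists [::]; split=> //; exact: val_inj.
  case: Tad => -[Te nk].
    have Ae : A (a, d).1 /\ A (a, d).2 by apply: edgeA => //; left.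
    have [p [wp np]] := IH d b Ae.2 Ab db.
    exists ((mkE _ Te Ae, false) :: p); split=> //=; split;
      first exact: val_inj.
    by rewrite (_ : orng _ = (SigSub (mem_set Ae.2) : vertex G))//;
      exact: val_inj.
  have Ae : A (d, a).1 /\ A (d, a).2 by apply: edgeA => //; right.
  have [p [wp np]] := IH d b Ae.1 Ab db.
  exists ((mkE _ Te Ae, true) :: p); split=> //=; split; first exact: val_inj.
  by rewrite (_ : orng _ = (SigSub (mem_set Ae.1) : vertex G))//;
    exact: val_inj.
move=> /(walks n _ _ A1 A2)[p [wp np]].
have [q [wq rq nq]] := walk_reduce wp np.
pose a : edge G * bool := (mkE k Tk (conj A1 A2), true).
suff : a :: q = [::] by [].
apply: (acyc (SigSub (mem_set A2))).
- split; first exact: val_inj.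
  by rewrite (_ : orng _ = (SigSub (mem_set A1) : vertex G))//; exact: val_inj.
- split=> //; case: q nq {wq rq} => // b q [+ _] [ab _]; apply.
  by rewrite -ab.
Qed.

Lemma toward_head k : toward T k k.1.
Proof. exact: linked_refl. Qed.

Lemma toward_tail k : T k -> ~ toward T k k.2.
Proof. by move=> Tk tk; apply: (edge_separates Tk); exact: linked_sym tk. Qed.

Lemma toward_other_edge k k' : T k' -> k <> k' ->
  toward T k k'.1 <-> toward T k k'.2.
Proof.
move=> Tk' kk'; have Tk : (T `\ k) (k'.1, k'.2).
  by rewrite -surjective_pairing; split=> // /esym.
by split; apply: linked_step; [right|left].
Qed.

(** Moving the vertex along one edge changes the orientation of no other
    edge. *)
Lemma toward_finite_diff v w : linked T v w ->
  finite_set [set k | T k /\ ~ (toward T k v <-> toward T k w)].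
Proof.
move=> [n]; elim: n v => [v ->|n IH v [c [Tvc /IH fin]]].
  by rewrite (_ : mkset _ = set0) // -subset0 => k [_]; apply.
have [k0 [Tk0 k0P]] : exists k0, T k0 /\
    forall k, k <> k0 -> toward T k v <-> toward T k c.
  case: Tvc => Te; [exists (v, c)|exists (c, v)]; split=> // k nk.
    by have := toward_other_edge Te nk.
  by have := toward_other_edge Te nk; tauto.
apply: (@sub_finite_set _ _ ([set k0] `|` [set k | T k /\
    ~ (toward T k c <-> toward T k w)])).
  move=> k [Tk nk]; case: (pselect (k = k0)) => [->|kk0]; first by left.
  by right; split=> //; have := k0P k kk0; tauto.
by rewrite finite_setU; split=> //; exact: finite_set1.
Qed.

(** The edge at [w] on the geodesic from [w] to [v]. *)
Lemma edge_on_geodesic v w : v <> w -> linked T v w ->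
  exists k, T k /\ (k.1 = w /\ ~ toward T k v \/ k.2 = w /\ toward T k v).
Proof.
move=> vw [n].
pose T' := [set k | T k /\ k.1 <> w /\ k.2 <> w].
have TT' k : k.1 = w \/ k.2 = w -> T' `<=` T `\ k.
  by move=> kw k' [Tk' [k'1 k'2]]; split=> // k'k; case: kw; rewrite -k'k.
suff gen z : linked T' v z -> z <> w -> chain T n z w ->
    exists k, T k /\ (k.1 = w /\ ~ toward T k v \/ k.2 = w /\ toward T k v).
  exact: gen (linked_refl _ _) vw.
elim: n z => [//|n IH z vz zw [c [Tzc cw]]].
case: (pselect (c = w)) => [cw'|cw'].
  rewrite {c cw}cw' in Tzc; case: Tzc => Te.
    exists (z, w); split=> //; right; split=> //.
    by apply: linked_sub vz; apply: TT'; right.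
  exists (w, z); split=> //; left; split=> // tw.
  apply: (edge_separates Te); apply: linked_trans (linked_sym tw) _.
  by apply: linked_sub vz; apply: TT'; left.
apply: IH cw => //; apply: linked_trans vz _.
by apply: linked_step (linked_refl _ _); case: Tzc => Te; [left|right].
Qed.

Implicit Type o : set (X * X).

(** An orientation of the edges is given by the set [o] of those edges [k]
    that point to [k.1]. *)
Definition sink o v := forall k, T k -> (k.1 = v -> o k) /\ (k.2 = v -> ~ o k).

Definition astray o v :=
  [set k | [/\ T k, linked T v k.1 & ~ (o k <-> toward T k v)]].

(** If [v] is not a sink, an edge at [v] points away from it; passing to the
    other end of this edge removes it from the set of edges that go astray
    and changes nothing else. *)
Lemma sink_exists o v : finite_set (astray o v) ->
  exists2 w, linked T v w & sink o w.
Proof.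
pose P : Type := {classic (X * X)%type}.
move=> /(@finite_seqP P)[s es].
have {es} : forall k : P, astray o v k -> k \in s by move=> k; rewrite es.
have [n] := ubnP (size s); elim: n s v => // n IH s v sn sub.
case: (pselect (sink o v)) => [sv|nsv]; first by exists v => //;
  exact: linked_refl.
have [k [w [Tk kvw okv]]] : exists k w, [/\ T k,
    k = (v, w) \/ k = (w, v) & o k <-> k.2 = v].
  apply: contrapT => h; apply: nsv => k Tk; have nloop : k.1 <> k.2.
    by move=> e; apply: (toward_tail Tk); rewrite -e; exact: toward_head.
  split=> kv.
    apply: contrapT => nok; apply: h; exists k, k.2; split=> //.
      by left; rewrite -kv -surjective_pairing.
    by split=> // e; case: nloop; rewrite kv.
  by move=> ok; apply: h; exists k, k.1; split=> //; right;
    rewrite -kv -surjective_pairing.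
have Tvw : T (v, w) \/ T (w, v) by case: kvw Tk => ->; [left|right].
have lvw : linked T v w by exact: linked_step Tvw (linked_refl _ _).
have nloop : v <> w.
  move=> e; apply: (toward_tail Tk); rewrite (_ : k.2 = k.1);
    first exact: toward_head.
  by case: kvw => ->; rewrite e.
have tkv : toward T k v <-> k.1 = v.
  case: kvw Tk {okv} => -> Tk; first by split=> // _; exact: toward_head.
  by split=> [/(toward_tail Tk)//|/= e]; case: nloop.
have tkw : toward T k w <-> k.1 = w.
  case: kvw Tk {okv tkv} => -> Tk; last by split=> // _; exact: toward_head.
  by split=> [/(toward_tail Tk)//|/= e]; case: nloop.
have ks : (k : P) \in s.
  apply: sub; split=> //.
    by case: kvw => ->; [exact: linked_refl|].
  rewrite okv tkv => -[h1 h2]; apply: nloop.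
  by case: kvw h1 h2 => -> /= h1 h2; apply: esym; [exact: h2|exact: h1].
have [||w' ww' sw'] := IH (rem (k : P) s) w.
- by rewrite size_rem// -ltnS; case: (s) ks sn.
- move=> k' [Tk' wk' nk']; case: (pselect (k' = k)) => [e|k'k].
    case: nk'; rewrite e okv tkw; case: kvw => -> /=; split=> //;
      exact: esym.
  apply: (@rem_mem P); first exact/eqP.
  apply: sub; split=> //; first exact: linked_trans lvw wk'.
  move=> h; apply: nk'; rewrite h.
  by have := toward_other_edge Tk k'k; case: kvw => -> /=; tauto.
by exists w' => //; exact: linked_trans ww'.
Qed.

(** The first edge on the geodesic from a sink to [v] goes astray, so the sink
    is an endpoint of one of finitely many edges, unless it is [v]. *)
Lemma sinks_finite o v : finite_set (astray o v) ->
  finite_set [set w | linked T v w /\ sink o w].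
Proof.
move=> fin; apply: (@sub_finite_set _ _ ([set v] `|`
  (fst @` astray o v `|` snd @` astray o v))); last first.
  by rewrite !finite_setU; split;
    [exact: finite_set1|split; exact: finite_image].
move=> w [vw sw]; case: (pselect (v = w)) => [->|nvw]; first by left.
right; have [k [Tk [[kw tk]|[kw tk]]]] := edge_on_geodesic nvw vw.
  left; exists k => //; split=> //; first by rewrite kw.
  by have ok := (sw k Tk).1 kw; tauto.
right; exists k => //; split=> //; last by have ok := (sw k Tk).2 kw; tauto.
apply: linked_trans vw _; apply: linked_step (linked_refl _ _).
by right; rewrite -kw -surjective_pairing.
Qed.

End Treeing.

(** * Finite sets and the lexicographic order *)

Lemma finite_set_min (T : Type) d (L : orderType d) (h : T -> L) (A : set T) :
  finite_set A -> A !=set0 ->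
  exists2 a, A a & forall b, A b -> (h a <= h b)%O.
Proof.
pose P : Type := {classic T}.
move=> /(@finite_seqP P)[s ->] {A}; elim: s => [|a s IH]; first by case.
move=> _; case: (pselect ([set` s] !=set0)) => [/IH[b bs bmin]|ns].
  case: (Order.TotalTheory.leP (h a) (h b)) => ab.
    exists a; first exact: mem_head.
    move=> x; rewrite /= inE => /predU1P[->//|/bmin];
      exact: Order.POrderTheory.le_trans.
  exists b; first by rewrite /= inE bs orbT.
  by move=> x; rewrite /= inE => /predU1P[->|/bmin//];
    exact: Order.POrderTheory.ltW.
exists a; first exact: mem_head.
move=> x; rewrite /= inE => /predU1P[->//|xs]; by case: ns; exists x.
Qed.

(** This turns finiteness into a statement with countable quantifiers. *)
Lemma finite_set_enum (T : Type) (g : nat -> T) (A : set T) :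
  (forall a, A a -> exists n, a = g n) ->
  finite_set A <-> exists N, forall n, A (g n) -> exists2 m, m < N & g m = g n.
Proof.
move=> gA; split=> [|[N hN]]; last first.
  apply: (@sub_finite_set _ _ (g @` `I_N)); last exact/finite_image/finite_II.
  move=> a Aa; have [n e] := gA a Aa; rewrite e in Aa *.
  by have [m mN <-] := hN n Aa; exists m.
pose P : Type := {classic T}.
move=> /(@finite_seqP P)[s As].
have {As} : forall n, A (g n) -> (g n : P) \in s by move=> n; rewrite As.
elim: s A gA => [|a s IH] A gA sub; first by exists 0 => n /sub.
have [b [/gA//]|n [An na]|N hN] := IH (A `\ a).
  by have := sub _ An; rewrite inE => /predU1P[].
case: (pselect (exists n, g n = a)) => [[k ka]|nk].
  exists (maxn N k.+1) => n An; case: (pselect (g n = a)) => [na|na].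
    by exists k; rewrite ?leq_max ?ltnSn ?orbT// ka.
  have [//|m mN mn] := hN n; exists m => //.
  by rewrite leq_max mN.
exists N => n An; apply: hN; split=> // na; apply: nk; by exists n.
Qed.

Lemma lexi_leP (a b : big_lexi_order (fun=> nat)) :
  (a <= b)%O <-> a = b \/ exists n, (forall i, i < n -> a i = b i) /\ a n < b n.
Proof.
rewrite leEbig_lexi_order; case E : (first_diff a b) => [n|]; last first.
  by split=> // _; left; apply/first_diff_NoneP.
have [pre /eqP ne] := (first_diff_SomeP _ _ _).1 E.
split=> [ab|[ab|[m [pre' ab]]]].
- right; exists n; split; first exact: pre.
  by have {}ab : a n <= b n := ab; rewrite ltn_neqAle ab andbT; exact/eqP.
- by rewrite ab in ne.
- have -> : n = m; last exact: ltnW.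
  by apply: (@first_diff_unique _ a b) => //; [exact/eqP|rewrite neq_ltn ab].
Qed.

Lemma borel_lexi_le (Y : borelType) (a b : Y -> nat -> nat) :
  @borel_map Y (seqB nat) a -> @borel_map Y (seqB nat) b ->
  borel Y [set y | ((a y : big_lexi_order (fun=> nat)) <= b y)%O].
Proof.
move=> ba bb; have bdigits n (P : nat -> nat -> Prop) :
    borel Y [set y | P (a y n) (b y n)].
  apply: (@borel_ext _ [set y | exists k, a y n = k /\ P k (b y n)]).
    by move=> y; split=> [[_ [<-]]//|Py]; exists (a y n).
  apply: borel_ex => k; apply: borel_and; first exact: ba _ (borel_digit n k).
  exact: (borel_digit_in _ _ bb).
apply: (@borel_ext _ [set y | a y = b y \/
    exists n, (forall i, i < n -> a y i = b y i) /\ a y n < b y n]).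
  by move=> y; split=> /lexi_leP.
apply: borel_or; first exact: borel_seq_eq.
apply: borel_ex => n; apply: borel_and;
  last exact: (bdigits n (fun j k => j < k)).
apply: borel_all => i; apply: borel_imp; first exact: borel_const.
exact: (bdigits i (fun j k => j = k)).
Qed.

Lemma Z2_eq (a b : 'Z_2) : (a = 1%R <-> b = 1%R) -> a = b.
Proof.
have Z2P (z : 'Z_2) : z = 0%R \/ z = 1%R.
  by case: z => -[|[|//]] lt; [left|right]; exact: val_inj.
by case: (Z2P a) (Z2P b) => -> [] -> // [];
  [move=> _ /(_ erefl)|move=> /(_ erefl)].
Qed.

(** * The edges of the treeing and their orientations *)

Section Application.
Variables (X : borelType) (R S : borelEquiv X) (T : set (X * X)).
Variables (c : X -> nat -> nat) (f : nat -> X -> X).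
Hypothesis SR : S `<=` R.
Hypothesis codeX : borel_code c.
Hypothesis treeingT : treeing S T.
Hypothesis borel_f : forall k, borel_map (f k).
Hypothesis enumR : forall x y, R (x, y) <-> exists k, y = f k x.
Hypothesis representatives : forall x, exists (n : nat) (v : 'I_n -> X),
  (forall i, R (x, v i)) /\ forall y, R (x, y) -> exists i, S (v i, y).

Let TR k : T k -> R (k.1, k.2).
Proof. by rewrite -surjective_pairing => Tk; apply: SR; case: treeingT =>
  _ TS _; exact: TS. Qed.

Let linkedR a b : linked T a b -> R (a, b).
Proof. by move=> /(treeing_linked treeingT)/SR. Qed.

Let borelT : borel (prodB X X) T.
Proof. by case: treeingT. Qed.

(** ** The field of edges *)

(** An edge is attached to all points of its [R]-class, in whichever tree of
    the class it lies. *)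
Definition edges x : set (X * X) := [set k | T k /\ R (x, k.1)].

Lemma edges_act x y : R (x, y) -> edges y `<=` edges x.
Proof. by move=> Rxy k [Tk Ryk]; split=> //;
  exact: Defs.equiv_trans Rxy Ryk. Qed.

Definition edge_incl (v : {x : X & edges x}) : prodB X (prodB X X) :=
  (projT1 v, val (projT2 v)).

Definition edge_field : Rfield R :=
  @MkRfield X R (fun x => edges x)
    (fun x y h e => SigSub (mem_set (edges_act h (set_valP e))))
    (borel (pullbackB edge_incl)) (borelP (pullbackB edge_incl)).

Local Notation E := edge_field.

Lemma edge_incl_inj : injective edge_incl.
Proof.
move=> [x e] [y e'] [/= xy]; case: _ / xy e' => e' ee'.
by congr existT; exact: val_inj.
Qed.

Lemma borel_edges (Y : borelType) (g : Y -> X) (k : Y -> X * X) :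
  borel_map g -> @borel_map Y (prodB X X) k ->
    borel Y [set y | edges (g y) (k y)].
Proof.
move=> bg bk; apply: borel_and; first exact: (bk _ borelT).
apply: (borel_preimage _ (equiv_borel R)).
by apply: borel_map_pair bg _; exact: borel_map_comp (@borel_map_fst X X) bk.
Qed.

Lemma range_edge_incl : range edge_incl = [set p : X * (X * X) | edges p.1 p.2].
Proof.
apply/seteqP; split=> [_ [[x e] _ <-]|[x k] /= ek]; first exact: (set_valP e).
by exists (existT _ x (SigSub (mem_set ek))).
Qed.

Lemma edge_code : exists (A : countType) (d : Defs.total E -> nat -> A),
  borel_code d.
Proof.
have cXX := borel_code_prod codeX (borel_code_prod codeX codeX).
exists (nat * (nat * nat))%type; eexists.
apply: (borel_code_sub (W := Defs.total E) cXX edge_incl_inj erefl).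
rewrite range_edge_incl; apply: borel_edges; first exact: borel_map_fst.
exact: borel_map_snd.
Qed.

Lemma borel_edge_incl : @borel_map (Defs.total E) (prodB X (prodB X X))
  edge_incl.
Proof. exact: borel_map_pullback. Qed.

Lemma borel_edge_base : @borel_map (Defs.total E) X (@projT1 X (fiber E)).
Proof. exact: (borel_map_comp (@borel_map_fst _ _) borel_edge_incl). Qed.

Lemma borel_composable (Y : Rfield R) :
  @borel_map (Defs.total Y) X (@projT1 X (fiber Y)) ->
  borel (prodB (prodB X X) (Defs.total Y)) (@composable X R Y).
Proof.
move=> bY; apply: borel_and.
  exact: (borel_preimage (@borel_map_fst _ _) (equiv_borel R)).
apply: (borel_code_eq codeX).
  exact: (borel_map_comp (@borel_map_snd _ _) (@borel_map_fst _ _)).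
exact: (borel_map_comp bY (@borel_map_snd _ _)).
Qed.

(** To see that an action is Borel, it suffices to compute it on composable
    pairs by a Borel formula with values in a space into which the field is
    embedded. *)
Lemma borel_action (Y : Rfield R) (Z : borelType) (i : Defs.total Y -> Z)
    (a : prodB (prodB X X) (Defs.total Y) -> Z) :
  borel (Defs.total Y) = borel (pullbackB i) ->
  @borel_map (Defs.total Y) X (@projT1 X (fiber Y)) -> borel_map a ->
  (forall x y (h : R (x, y)) (v : fiber Y y),
    a ((x, y), existT _ y v) = i (existT _ x (act h v))) ->
  borel_fun (@composable X R Y) (@action_map X R Y).
Proof.
move=> bYi bY ba aE B; rewrite bYi => -[B' bB' <-]; rewrite setTI.
apply: (@borel_ext _ [set gv | composable gv /\ B' (a gv)]); last first.
  by apply: borel_and; [exact: borel_composable|exact: ba].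
suff act_a gv : composable gv -> i (action_map gv) = a gv.
  by move=> gv; split=> [[cgv /= Bgv]|[cgv /= Bgv]]; split=> //;
    rewrite ?act_a// -?act_a.
move: gv => [[x y] [y' v]] [/= h e]; case: _ / e v => v.
rewrite /action_map /=; case: pselect => [h'|/(_ h)//] /=.
by rewrite aE.
Qed.

Lemma edge_Rspace (K : realType) : countable_Rset K E.
Proof.
split; first split.
- by move=> x h v; exact: val_inj.
- by move=> x y z h k l v; exact: val_inj.
- by have [A [d cd]] := edge_code; exact: borel_code_standard cd.
- exact: borel_map_borel_fun borel_edge_base.
- apply: (@borel_action E (prodB X (prodB X X)) edge_incl
    (fun gv => (gv.1.1, (edge_incl gv.2).2))) => //.
  + exact: borel_edge_base.
  + apply: borel_map_pair.
      exact: (borel_map_comp (@borel_map_fst _ _) (@borel_map_fst _ _)).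
    exact: (borel_map_comp (@borel_map_snd _ _)
      (borel_map_comp borel_edge_incl (@borel_map_snd _ _))).
move=> x; apply/countable_injP.
have /choice[n nP] (e : edges x) : exists n : nat * nat,
    val e = (f n.1 x, f n.2 x).
  have [Te Re] := set_valP e.
  have [i ei] := (enumR x (val e).1).1 Re.
  have [j ej] := (enumR x (val e).2).1 (Defs.equiv_trans Re (TR Te)).
  by exists (i, j); rewrite [LHS]surjective_pairing ei ej.
exists (pickle \o n) => e e' _ _ /= /(pcan_inj pickleK) ee'.
by apply: val_inj; rewrite /= nP ee' -nP.
Qed.

(** Each edge lies in the fibre over its own source exactly once. *)
Lemma edge_quasi_periodic : quasi_periodic E.
Proof.
exists [set v : Defs.total E | (edge_incl v).1 = (edge_incl v).2.2]; split.
  apply: (borel_code_eq codeX); first exact: borel_edge_base.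
  exact: (borel_map_comp (@borel_map_snd _ _)
    (borel_map_comp (@borel_map_snd _ _) borel_edge_incl)).
move=> [x e]; have [Te Re] := set_valP e.
have h : R ((val (e : edges x)).2, x).
  by apply: Defs.equiv_sym; exact: Defs.equiv_trans Re (TR Te).
exists (existT _ (val (e : edges x)).2 (@act X R E _ _ h e)); split.
  by split=> //; exists (val (e : edges x)).2, h.
move=> w [Dw [y [h' ew]]]; move: Dw; rewrite ew /= => yE.
by apply: edge_incl_inj; rewrite /edge_incl /= -yE.
Qed.

(** ** The field of orientations *)

(** All candidates for the edges over [x]; those in [T] are indeed edges. *)
Definition nth_pair n x : X * X :=
  let p := odflt (0, 0) (@unpickle (nat * nat)%type n) in (f p.1 x, f p.2 x).

Lemma nth_pair_edge n x : T (nth_pair n x) -> edges x (nth_pair n x).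
Proof. by move=> Tn; split=> //; apply/enumR; eexists. Qed.

Lemma edge_nth_pair x k : edges x k -> exists n, k = nth_pair n x.
Proof.
move=> [Tk Rk]; have [i ei] := (enumR x k.1).1 Rk.
have [j ej] := (enumR x k.2).1 (Defs.equiv_trans Rk (TR Tk)).
by exists (pickle (i, j)); rewrite /nth_pair pickleK /= -ei -ej
  -surjective_pairing.
Qed.

Lemma borel_nth_pair n : @borel_map X (prodB X X) (nth_pair n).
Proof. exact: borel_map_pair. Qed.

Local Notation PF := (power_field E).

Definition digits x (u : edges x -> 'Z_2) n : 'Z_2 :=
  if pselect (T (nth_pair n x)) is left h
  then u (SigSub (mem_set (nth_pair_edge h))) else 0%R.

Lemma digitsE x (u : edges x -> 'Z_2) n (e : edges x) :
  val e = nth_pair n x -> digits u n = u e.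
Proof.
move=> en; rewrite /digits; case: pselect => [h|[]].
  by congr u; exact: val_inj.
by rewrite -en; case: (set_valP e).
Qed.

Lemma digits_out x (u : edges x -> 'Z_2) n :
  ~ T (nth_pair n x) -> digits u n = 0%R.
Proof. by rewrite /digits; case: pselect. Qed.

Lemma digits_inj x (u v : edges x -> 'Z_2) : digits u = digits v -> u = v.
Proof.
move=> uv; apply/funext => e; have [n en] := edge_nth_pair (set_valP e).
by rewrite -(digitsE u en) uv (digitsE v en).
Qed.

Definition power_incl (v : {x : X & edges x -> 'Z_2}) : prodB X (seqB 'Z_2) :=
  (projT1 v, digits (projT2 v)).

Lemma power_incl_inj : injective power_incl.
Proof.
move=> [x u] [y v] [/= xy]; case: _ / xy v => v uv.
by congr existT; exact: digits_inj.
Qed.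

(** The evaluations along the sections [nth_pair n] determine all others. *)
Lemma power_borel : borel (Defs.total PF) = borel (pullbackB power_incl).
Proof.
apply/seteqP; split=> D.
  have bid : @borel_map (pullbackB power_incl) (Defs.total PF) id.
    have bpi := @borel_map_pullback (prodB X (seqB 'Z_2)) _ power_incl.
    have bbase := borel_map_comp (@borel_map_fst _ _) bpi.
    have bdig := borel_map_comp (@borel_map_snd _ _) bpi.
    apply: borel_map_generated => _ [[A bA <-]|[B [bB uB] [z _ <-]]].
      exact: bbase _ bA.
    have [B' bB' BB'] := bB; rewrite setTI in BB'.
    apply: (@borel_ext (pullbackB power_incl) [set v |
      exists n, T (nth_pair n (projT1 v)) /\
        (B' (projT1 v, nth_pair n (projT1 v)) /\ digits (projT2 v) n = z)]).
      move=> [x u]; split=> [[n [/= Tn [Bn un]]]|[/= e Be ue]].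
        exists (SigSub (mem_set (nth_pair_edge Tn))).
          by rewrite -BB'.
        by rewrite /= -un; apply/esym; exact: digitsE.
      have [n en] := edge_nth_pair (set_valP e).
      exists n; split=> /=; first by rewrite -en; case: (set_valP e).
      split; first by move: Be; rewrite -BB' /preimage /= /edge_incl /= en.
      by rewrite (digitsE u en).
    apply: borel_ex => n; have bn := borel_map_comp (borel_nth_pair n) bbase.
    apply: borel_and; first exact: bn _ borelT.
    apply: borel_and; first exact: borel_map_pair bbase bn _ bB'.
    exact: bdig _ (borel_digit n z).
  exact: bid.
move=> [D' bD' <-]; rewrite setTI.
have bbase : @borel_map (Defs.total PF) X (@projT1 X (fiber PF)).
  by move=> A bA; apply: sub_sigma_algebra; left; exists A.
suff bpi : @borel_map (Defs.total PF) (prodB X (seqB 'Z_2)) power_incl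
  by exact: bpi.
apply: (borel_map_pair bbase); apply: borel_map_seq => n z.
pose B : set (Defs.total E) :=
  [set w | (edge_incl w).2 = nth_pair n (edge_incl w).1].
have sB : @partial_section X R E B.
  split.
    apply: (borel_code_eq (borel_code_prod codeX codeX)).
      exact: (borel_map_comp (@borel_map_snd _ _) borel_edge_incl).
    exact: (borel_map_comp (borel_nth_pair n) borel_edge_base).
  move=> v w; rewrite /B /= => Bv Bw vw; apply: edge_incl_inj.
  congr (_, _) => //.
  exact: (etrans Bv (etrans (congr1 (nth_pair n) vw) (esym Bw))).
apply: (@borel_ext (Defs.total PF) [set v | T (nth_pair n (projT1 v)) /\
  @evaluation_set X R E B z v \/ ~ T (nth_pair n (projT1 v)) /\ 0%R = z]).
  move=> [x u]; split=> [[[Tn [/= e Be ue]]|[nTn <-]]|/= un].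
  - by rewrite (digitsE u Be).
  - exact: digits_out.
  - case: (pselect (T (nth_pair n x))) => [Tn|nTn]; last first.
      by right; split=> //; rewrite -un digits_out.
    left; split=> //; exists (SigSub (mem_set (nth_pair_edge Tn))) => //.
    by rewrite -un; apply/esym; exact: digitsE.
have bn := borel_map_comp (borel_nth_pair n) bbase.
have bTn := bn _ borelT.
apply: borel_or; apply: borel_and.
- exact: bTn.
- by apply: sub_sigma_algebra; right; exists B => //; exists z.
- exact: borel_not.
- exact: borel_const.
Qed.

(** An element [u] of the power set of the edges orients each edge [k], towards
    [k.1] if [u] takes the value [1] at [k], towards [k.2] otherwise.  As a set
    of pairs, the orientation no longer mentions [x]. *)
Definition orient x (u : edges x -> 'Z_2) : set (X * X) :=
  [set k | exists2 e : edges x, val e = k & u e = 1%R].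

Lemma orient_edge x (u : edges x -> 'Z_2) (e : edges x) :
  orient u (val e) <-> u e = 1%R.
Proof. by split=> [[e' /val_inj ->]|ue]//; exists e. Qed.

Lemma orient_nth_pair x (u : edges x -> 'Z_2) n :
  T (nth_pair n x) -> orient u (nth_pair n x) <-> digits u n = 1%R.
Proof.
move=> Tn; pose e : edges x := SigSub (mem_set (nth_pair_edge Tn)).
by rewrite (@digitsE _ u n e)//; exact: (orient_edge u e).
Qed.

Lemma orient_act x y (h : R (x, y)) (u : edges y -> 'Z_2) :
  orient (@act X R PF x y h u) = orient u.
Proof.
apply/seteqP; split=> k [e <- ue].
  by exists (@act X R E _ _ (Defs.equiv_sym h) e).
exists (@act X R E _ _ h e) => //; rewrite -ue; congr u; exact: val_inj.
Qed.

(** ** The almost equality class of the vertices *)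

(** On each of the finitely many trees in the class of [x], the orientation
    agrees with the one towards a vertex, up to finitely many edges. *)
Definition tame x (u : edges x -> 'Z_2) : Prop :=
  forall v, R (x, v) -> finite_set (astray T (orient u) v).

(** The reference element orients all edges of each tree towards the chosen
    vertex of that tree.  The index being finite, only finitely many trees
    contribute to the set where another element differs from it. *)
Lemma tame_almost_equality_class x : almost_equality_class (@tame x).
Proof.
have [n [v [Rv vS]]] := representatives x.
have ex (e : edges x) : exists i, S (v i, (val e).1).
  by apply: vS; case: (set_valP e).
have [i iP] := choice ex.
pose w (e : edges x) : 'Z_2 :=
  if `[< toward T (val e) (v (i e)) >] then 1%R else 0%R.
exists w.
have wE e : w e = 1%R <-> toward T (val e) (v (i e)).
  by rewrite /w; case: asboolP.
apply/seteqP; split=> u.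
  move=> tu; apply: (@sub_finite_set _ _
    (val @^-1` \bigcup_j astray T (orient u) (v j))); last first.
    apply: finite_preimage; first by move=> ? ? _ _; exact: val_inj.
    by apply: bigcup_finite => // j _; exact: tu.
  move=> e /= wu; exists (i e) => //; split.
  - by case: (set_valP e).
  - exact/(treeing_linked treeingT).
  - rewrite orient_edge -wE => uw; apply: wu; apply: Z2_eq; tauto.
move=> wu y Rxy.
pose D j := [set k | linked T y (v j) /\
  (T k /\ ~ (toward T k y <-> toward T k (v j)))].
apply: (@sub_finite_set _ _ ((val @` [set e | w e <> u e]) `|` \bigcup_j D j)).
  move=> k [Tk yk ok].
  have ek : edges x k by split=> //; exact: Defs.equiv_trans Rxy (linkedR yk).
  pose e : edges x := SigSub (mem_set ek).
  case: (pselect (w e = u e)) => we; last by left; exists e.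
  right; exists (i e) => //; split.
    apply: linked_trans yk (linked_sym _).
    exact/(treeing_linked treeingT)/(iP e).
  split=> //; have := orient_edge u e; have := wE e; rewrite we.
  by rewrite /=; tauto.
rewrite finite_setU; split; first exact: finite_image.
apply: bigcup_finite => // j _; case: (pselect (linked T y (v j))) => yv.
  by apply: (sub_finite_set _ (toward_finite_diff yv)) => k [].
by rewrite (_ : D j = set0)// -subset0 => k [].
Qed.

Lemma tame_act x y (h : R (x, y)) (u : edges y -> 'Z_2) :
  tame u -> tame (@act X R PF x y h u).
Proof.
move=> tu v Rxv; rewrite orient_act; apply: tu.
exact: Defs.equiv_trans (Defs.equiv_sym h) Rxv.
Qed.

Lemma act_sym x y (h : R (x, y)) (u : fiber PF x) :
  @act X R PF x y h (@act X R PF y x (Defs.equiv_sym h) u) = u.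
Proof. by apply/funext => e; congr u; exact: val_inj. Qed.

Lemma tame_image x y (h : R (x, y)) :
  @act X R PF x y h @` [set u | tame u] = [set u | tame u].
Proof.
apply/seteqP; split=> [_ [u tu <-]|u tu]; first exact: tame_act.
by exists (@act X R PF y x (Defs.equiv_sym h) u);
  [exact: tame_act|exact: act_sym].
Qed.

Lemma borel_step (Y : borelType) (k : Y -> X * X) (a b : Y -> X) :
  @borel_map Y (prodB X X) k -> borel_map a -> borel_map b ->
  borel Y [set y | (T `\ k y) (a y, b y)].
Proof.
move=> bk ba bb; have bab := borel_map_pair ba bb.
apply: borel_and; first exact: bab _ borelT.
apply: borel_not; apply: (borel_code_eq (borel_code_prod codeX codeX)) => //.
Qed.

Lemma borel_chain n (Y : borelType) (k : Y -> X * X) (a b : Y -> X) :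
  @borel_map Y (prodB X X) k -> borel_map a -> borel_map b ->
  borel Y [set y | chain (T `\ k y) n (a y) (b y)].
Proof.
move=> bk + bb; elim: n a => [|n IH] a ba;
  first exact: borel_code_eq codeX ba bb.
apply: (@borel_ext _ [set y | exists i,
  ((T `\ k y) (a y, f i (a y)) \/ (T `\ k y) (f i (a y), a y)) /\
  chain (T `\ k y) n (f i (a y)) (b y)]).
  move=> y; split=> [[i [st ch]]|[d [st ch]]]; first by exists (f i (a y)).
  have [i e] : exists i, d = f i (a y).
    apply/enumR; case: st => -[/TR Rad _] //; exact: Defs.equiv_sym.
  by exists i; rewrite -e.
apply: borel_ex => i; have bi := borel_map_comp (borel_f i) ba.
apply: borel_and; last exact: IH.
by apply: borel_or; exact: borel_step.
Qed.

Lemma borel_toward (Y : borelType) (k : Y -> X * X) (v : Y -> X) :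
  @borel_map Y (prodB X X) k -> borel_map v ->
  borel Y [set y | toward T (k y) (v y)].
Proof.
move=> bk bv; apply: borel_ex => n; apply: borel_chain => //.
exact: borel_map_comp (@borel_map_fst X X) bk.
Qed.

Local Notation XZ := (prodB X (seqB 'Z_2)).

(** The counterpart of [astray] in terms of digits. *)
Definition stray m n : set (X * (nat -> 'Z_2)) := [set p |
  T (nth_pair n p.1) /\ (S (f m p.1, (nth_pair n p.1).1) /\
  ~ (p.2 n = 1%R <-> toward T (nth_pair n p.1) (f m p.1)))].

Definition tame_digits : set (X * (nat -> 'Z_2)) := [set p |
  forall m, exists N, forall n, stray m n p ->
    exists n', n' < N /\ nth_pair n' p.1 = nth_pair n p.1].

Let bbase : @borel_map XZ X fst.
Proof. exact: borel_map_fst. Qed.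

Let bpair n : @borel_map XZ (prodB X X) (fun p => nth_pair n p.1).
Proof. exact: borel_map_comp (borel_nth_pair n) bbase. Qed.

Let bpoint m : @borel_map XZ X (fun p => f m p.1).
Proof. exact: borel_map_comp (borel_f m) bbase. Qed.

Let bdigit n z : borel XZ [set p | p.2 n = z].
Proof. exact: (@borel_map_snd X (seqB 'Z_2) _ (borel_digit n z)). Qed.

Let bsame n m : borel XZ [set p | nth_pair n p.1 = nth_pair m p.1].
Proof. exact: (borel_code_eq (borel_code_prod codeX codeX)). Qed.

(** All quantifiers are countable, since the vertices and the edges over a
    point are enumerated. *)
Lemma borel_tame_digits : borel XZ tame_digits.
Proof.
apply: borel_all => m; apply: borel_ex => N; apply: borel_all => n.
apply: borel_imp.
  apply: borel_and; first exact: bpair borelT.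
  apply: borel_and.
    apply: (borel_preimage _ (equiv_borel S)).
    apply: borel_map_pair; first exact: bpoint.
    exact: borel_map_comp (@borel_map_fst X X) (bpair n).
  apply: borel_not; apply: borel_iff; first exact: bdigit.
  by apply: borel_toward; [exact: bpair|exact: bpoint].
apply: borel_ex => n'; apply: borel_and; first exact: borel_const.
exact: bsame.
Qed.

Lemma tame_digitsP x (u : edges x -> 'Z_2) :
  tame u <-> tame_digits (x, digits u).
Proof.
have astrayP m n : astray T (orient u) (f m x) (nth_pair n x) <->
    stray m n (x, digits u).
  split=> [[Tn ln un]|[/= Tn [Sn un]]].
    split=> //; split; first exact/(treeing_linked treeingT).
    by rewrite -(orient_nth_pair u Tn).
  split=> //; first exact/(treeing_linked treeingT).
  by rewrite (orient_nth_pair u Tn).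
have enum m k : astray T (orient u) (f m x) k -> exists n, k = nth_pair n x.
  move=> [Tk lk _]; apply: edge_nth_pair; split=> //.
  by apply: Defs.equiv_trans (linkedR lk); apply/enumR; exists m.
split=> [tu m|tu v /enumR[m ->]].
  have /(finite_set_enum (enum m))[N hN] :
    finite_set (astray T (orient u) (f m x)).
    by apply: tu; apply/enumR; exists m.
  by exists N => n /astrayP/hN[n' n'N e]; exists n'.
apply/(finite_set_enum (enum m)); have [N hN] := tu m.
by exists N => n /astrayP/hN[n' [n'N e]]; exists n'.
Qed.

Lemma tame_stable :
  stable_almost_equality_class (fun x => [set u : power_fiber E x | tame u]).
Proof.
split.
- rewrite -[borel _ _]/(borel (Defs.total PF) _) power_borel.
  exists tame_digits; first exact: borel_tame_digits.
  by rewrite setTI; apply/seteqP; split=> -[x u] /tame_digitsP.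
- by move=> x; exact: tame_almost_equality_class.
- exact: tame_image.
Qed.

(** An edge may occur several times among the candidates. *)
Definition consistent : set (X * (nat -> 'Z_2)) := [set p |
  forall n, (~ T (nth_pair n p.1) -> p.2 n = 0%R) /\
    forall m, T (nth_pair n p.1) -> nth_pair n p.1 = nth_pair m p.1 ->
      exists z, p.2 n = z /\ p.2 m = z].

Lemma range_power_incl : range power_incl = consistent.
Proof.
apply/seteqP; split=> [_ [[x u] _ <-] n /=|[x z] zc].
  split=> [nTn|m Tn nm]; first exact: digits_out.
  pose e : edges x := SigSub (mem_set (nth_pair_edge Tn)).
  by exists (u e); rewrite (@digitsE _ u n e)// (@digitsE _ u m e)//= nm.
have [n nP] := choice (fun e : edges x => edge_nth_pair (set_valP e)).
exists (existT _ x (fun e => z (n e))) => //; rewrite /power_incl /=.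
congr (_, _); apply/funext => m; case: (pselect (T (nth_pair m x))) => Tm;
  last first.
  by rewrite digits_out//; have [/(_ Tm) /= ->] := zc m.
pose e : edges x := SigSub (mem_set (nth_pair_edge Tm)).
rewrite (@digitsE _ _ m e)//.
by have [_ /(_ (n e) Tm (nP e))[a [/= -> ->]]] := zc m.
Qed.

Lemma power_code : exists (A : countType) (d : Defs.total PF -> nat -> A),
  borel_code d.
Proof.
exists (nat * 'Z_2)%type; eexists.
apply: (borel_code_sub (W := Defs.total PF)
  (borel_code_prod codeX (@borel_code_id 'Z_2)) power_incl_inj power_borel).
rewrite range_power_incl; apply: borel_all => n; have bTn := bpair n borelT.
apply: borel_and.
  by apply: borel_imp; [exact: borel_not|exact: bdigit].
apply: borel_all => m; apply: borel_imp; first exact: bTn.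
apply: borel_imp; first exact: bsame.
by apply: borel_ex => z; apply: borel_and; exact: bdigit.
Qed.

(** ** The class of tame orientations *)

Local Notation V := (class_field tame_stable).

Lemma tame_incl_inj : injective (@class_incl X R E (fun x => [set u | tame u])).
Proof.
move=> [x u] [y v] /= e; have xy := congr1 (@projT1 _ _) e; rewrite /= in xy.
case: _ / xy v e => v e; congr existT; apply: val_inj.
exact: digits_inj (congr1 (fun w => (power_incl w).2) e).
Qed.

Lemma range_tame_incl : range (@class_incl X R E (fun x => [set u | tame u])) =
  [set v | tame (projT2 v)].
Proof.
apply/seteqP; split=> [_ [[x u] _ <-]|[x u] /= tu]; first exact: (set_valP u).
by exists (existT _ x (SigSub (mem_set tu))).
Qed.

Definition tame_digit_incl (v : Defs.total V) : XZ := power_incl (class_incl v).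

Lemma tame_borel : borel (Defs.total V) = borel (pullbackB tame_digit_incl).
Proof.
rewrite -[LHS]/(borel (pullbackB
  (@class_incl X R E (fun x => [set u | tame u])))).
apply/seteqP; split=> D [B + <-].
  by rewrite power_borel => -[B' bB' <-]; exists B'; rewrite // !setTI.
move=> bB; exists (power_incl @^-1` B); last by rewrite !setTI.
by rewrite power_borel; exists B; rewrite // setTI.
Qed.

Lemma borel_tame_digit_incl : @borel_map (Defs.total V) XZ tame_digit_incl.
Proof. by move=> B bB; rewrite tame_borel; exact: borel_map_pullback. Qed.

Lemma borel_tame_base : @borel_map (Defs.total V) X (@projT1 X (fiber V)).
Proof. exact: (borel_map_comp (@borel_map_fst _ _) borel_tame_digit_incl). Qed.

Lemma tame_Rspace (K : realType) : is_Rspace K V.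
Proof.
split.
- move=> x h v; apply: val_inj; apply/funext => e /=; congr (val v _);
  exact: val_inj.
- move=> x y z h k l v; apply: val_inj; apply/funext => e /=; congr (val v _).
  exact: val_inj.
- have [A [d cd]] := power_code; apply: borel_code_standard.
  apply: (borel_code_sub (W := Defs.total V) cd tame_incl_inj erefl).
  by rewrite range_tame_incl; exact: (class_borel tame_stable).
- exact: borel_map_borel_fun borel_tame_base.
pose on (gv : prodB (prodB X X) (Defs.total V)) n := T (nth_pair n gv.1.1) /\
  exists m, nth_pair m (tame_digit_incl gv.2).1 = nth_pair n gv.1.1 /\
            (tame_digit_incl gv.2).2 m = 1%R.
apply: (@borel_action V XZ tame_digit_incl
  (fun gv => (gv.1.1, fun n => if `[< on gv n >] then 1%R else 0%R)) tame_borel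
  borel_tame_base).
  have bx : @borel_map (prodB (prodB X X) (Defs.total V)) X (fun gv => gv.1.1).
    exact: (borel_map_comp (@borel_map_fst _ _) (@borel_map_fst _ _)).
  have bi := borel_map_comp borel_tame_digit_incl
    (@borel_map_snd (prodB X X) (Defs.total V)).
  apply: (borel_map_pair bx); apply: borel_map_seq => n z.
  have bon : borel (prodB (prodB X X) (Defs.total V)) [set gv | on gv n].
    have bnx := borel_map_comp (borel_nth_pair n) bx.
    apply: borel_and; first exact: bnx _ borelT.
    apply: borel_ex => m; apply: borel_and; last exact: bi _ (bdigit m 1%R).
    apply: (borel_code_eq (borel_code_prod codeX codeX)).
      exact: (borel_map_comp (bpair m) bi).
    exact: (borel_map_comp (borel_nth_pair n) bx).
  apply: (@borel_ext _ [set gv | on gv n /\ 1%R = z \/ ~ on gv n /\ 0%R = z]).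
    move=> gv /=; case: (pselect (on gv n)) => h.
      by rewrite asboolT//; tauto.
    by rewrite asboolF//; tauto.
  apply: borel_or; apply: borel_and;
    [exact: bon|exact: borel_const| |exact: borel_const].
  exact: borel_not.
move=> x y h v; congr (_, _); apply/funext => n; apply: Z2_eq.
pose u : edges y -> 'Z_2 := val v.
rewrite -[X in _ <-> X]/(digits (@act X R PF x y h u) n = 1%R).
split=> [|un].
  case: asboolP => // -[/= Tn [m [mn um]]] _.
  rewrite -orient_nth_pair// orient_act -mn orient_nth_pair//.
  by rewrite mn.
have Tn : T (nth_pair n x).
  by apply: contrapT => nTn; move: un; rewrite digits_out.
rewrite asboolT//; split=> //=.
have [Ty Ry] := edges_act (Defs.equiv_sym h) (nth_pair_edge Tn).
have [m mE] := edge_nth_pair (conj Ty Ry : edges y _).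
exists m; split; first exact: esym mE.
suff : digits u m = 1%R by [].
by rewrite -orient_nth_pair -?mE // -(orient_act h) orient_nth_pair.
Qed.

(** ** A fundamental domain for the class of tame orientations *)

Definition code_order x : big_lexi_order (fun=> nat) := c x.

(** The base point is the first sink of the orientation, in the order of the
    codes. *)
Definition rooted (w : {x : X & edges x -> 'Z_2}) : Prop :=
  sink T (orient (projT2 w)) (projT1 w) /\
  forall v, R (projT1 w, v) -> sink T (orient (projT2 w)) v ->
    (code_order (projT1 w) <= code_order v)%O.

(** Finiteness uses that the class of [x] contains finitely many trees. *)
Lemma tame_sinks x (u : edges x -> 'Z_2) : tame u ->
  finite_set [set v | R (x, v) /\ sink T (orient u) v] /\
  [set v | R (x, v) /\ sink T (orient u) v] !=set0.
Proof.
move=> tu; split; last first.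
  have [w xw sw] := sink_exists treeingT (tu x (Defs.equiv_refl R x)).
  by exists w; split=> //; exact: linkedR.
have [n [v [Rv vS]]] := representatives x.
apply: (@sub_finite_set _ _ (\bigcup_i [set w | linked T (v i) w /\
    sink T (orient u) w])).
  move=> w [/vS[i Siw] sw]; exists i => //; split=> //.
  exact/(treeing_linked treeingT).
by apply: bigcup_finite => // i _; apply: (sinks_finite treeingT); exact: tu.
Qed.

Lemma borel_rooted :
  borel (Defs.total V) [set v : Defs.total V | rooted (class_incl v)].
Proof.
(* Over [x], all edges at a vertex of the class are among the [nth_pair n x]. *)
pose dsink (p : X * (nat -> 'Z_2)) v := forall n, T (nth_pair n p.1) ->
  ((nth_pair n p.1).1 = v -> p.2 n = 1%R) /\
  ((nth_pair n p.1).2 = v -> ~ p.2 n = 1%R).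
have dsinkP x (u : edges x -> 'Z_2) v : R (x, v) ->
    dsink (x, digits u) v <-> sink T (orient u) v.
  move=> Rxv; split=> [su k Tk|su n Tn]; last first.
    by have := su _ Tn; have := orient_nth_pair u Tn; rewrite /=; tauto.
  suff kv : k.1 = v \/ k.2 = v -> edges x k.
    split=> kv'.
      have [n e] := edge_nth_pair (kv (or_introl kv')); rewrite e in Tk kv' *.
      by have [] := su n Tk; have := orient_nth_pair u Tk; rewrite /=; tauto.
    have [n e] := edge_nth_pair (kv (or_intror kv')); rewrite e in Tk kv' *.
    by have [] := su n Tk; have := orient_nth_pair u Tk; rewrite /=; tauto.
  case=> kv; split=> //; first by rewrite kv.
  by apply: Defs.equiv_trans Rxv _; rewrite -kv; exact/Defs.equiv_sym/TR.
have bsink (v : X -> X) : borel_map v -> borel XZ [set p | dsink p (v p.1)].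
  move=> bv; apply: borel_all => n.
  apply: borel_imp; first exact: bpair borelT.
  apply: borel_and; apply: borel_imp.
  - apply: (borel_code_eq codeX).
      exact: (borel_map_comp (@borel_map_fst X X) (bpair n)).
    exact: (borel_map_comp bv bbase).
  - exact: bdigit.
  - apply: (borel_code_eq codeX).
      exact: (borel_map_comp (@borel_map_snd X X) (bpair n)).
    exact: (borel_map_comp bv bbase).
  - by apply: borel_not; exact: bdigit.
apply: (@borel_ext _ [set v | [set p : X * (nat -> 'Z_2) | dsink p p.1 /\
    forall m, dsink p (f m p.1) ->
      (code_order p.1 <= code_order (f m p.1))%O] (tame_digit_incl v)]).
  move=> [x u]; split=> [[sx h]|[sx h]].
    split; first exact/(dsinkP _ _ _ (Defs.equiv_refl R x)).
    move=> v Rxv /(dsinkP _ _ _ Rxv); have [m ->] := (enumR x v).1 Rxv.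
    exact: h.
  split; first exact/(dsinkP _ _ _ (Defs.equiv_refl R x)).
  have Rm m : R (x, f m x) by apply/enumR; exists m.
  by move=> m /(dsinkP _ _ _ (Rm m)); exact: h.
apply: (borel_preimage borel_tame_digit_incl).
apply: borel_and; first exact: (bsink id (@borel_map_id X)).
apply: borel_all => m; apply: borel_imp; first exact: bsink.
have bc := borel_code_map codeX.
apply: borel_lexi_le; first exact: (borel_map_comp bc bbase).
exact: (borel_map_comp bc (bpoint m)).
Qed.

(** The sinks of an orientation do not depend on the point of the class over
    which it is taken, so each orbit has exactly one rooted point. *)
Lemma tame_quasi_periodic : quasi_periodic V.
Proof.
exists [set v : Defs.total V | rooted (class_incl v)]; split.
  exact: borel_rooted.
move=> [x u]; have tu : tame (val u : edges x -> 'Z_2) by exact: (set_valP u).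
have [fin ne] := tame_sinks tu.
have [s [Rxs ss] smin] := finite_set_min code_order fin ne.
have h := Defs.equiv_sym Rxs.
exists (existT _ s (@act X R V s x h u)); split.
  split; last by exists s, h.
  split; first by rewrite /= orient_act.
  move=> v Rsv; rewrite /= orient_act => sv; apply: smin; split=> //.
  exact: Defs.equiv_trans Rxs Rsv.
move=> w [Dw [y [h' ew]]]; move: Dw; rewrite {}ew /rooted /= orient_act =>
  -[sy ymin].
have sy' : s = y.
  have injc : injective code_order by case: codeX.
  apply: injc; apply: Order.POrderTheory.le_anti; apply/andP; split.
    by apply: smin; split=> //; exact: Defs.equiv_sym.
  by apply: ymin => //; exact: Defs.equiv_trans h' Rxs.
by subst y; rewrite (Prop_irrelevance h' h).
Qed.

End Application.

Theorem theorem1p1 (K : realType) (X : borelType) (R S : borelEquiv X)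
    (X_standard : standard_borel K X)
    (S_sub_R : S `<=` R)
    (S_treeable : treeable S)
    (S_finite_index : finite_index S R) :
  exists E : Rfield R,
    [/\ countable_Rset K E, quasi_periodic E &
        exists (V : forall x : X, set (power_fiber E x))
               (hV : stable_almost_equality_class V),
          is_Rspace K (class_field hV) /\ quasi_periodic (class_field hV)].
Proof.
have [T treeingT] := S_treeable.
have [c codeX] := standard_borel_code X_standard.
have reps x : exists (n : nat) (v : 'I_n -> X),
    (forall i, R (x, v i)) /\ forall y, R (x, y) -> exists i, S (v i, y).
  have [m [A [cover _ indexed]]] := S_finite_index.
  have [i _ Aix] : (\bigcup_i A i) x by rewrite cover.
  have [_ _ [n [g [_ /(_ x Aix)[classes _ _]]]]] := indexed i.
  exists n, (fun i => g i x); split=> [j|y Rxy].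
    suff : class_of R x (g j x) by [].
    by rewrite -classes; exists j => //; exact: Defs.equiv_refl.
  have : class_of R x y by [].
  by rewrite -classes => -[j _ Sjy]; exists j.
have countR x : countable [set y | R (x, y)].
  have [n [v [_ vS]]] := reps x.
  apply: (@sub_countable _ _ _ (\bigcup_i class_of S (v i))).
    by apply: subset_card_le => y /vS[i Siy]; exists i.
  by apply: bigcup_countable => // i _;
    exact: treeing_class_countable treeingT _.
have [f [borel_f enumR]] :=
  borel_enumeration codeX (equiv_borel R) (Defs.equiv_refl R) countR.
exists (edge_field R T); split.
- exact: edge_Rspace S_sub_R codeX treeingT enumR K.
- exact: edge_quasi_periodic S_sub_R codeX treeingT.
exists (fun x => [set u : power_fiber (edge_field R T) x | tame u]).
exists (tame_stable S_sub_R codeX treeingT borel_f enumR reps).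
by split; [exact: tame_Rspace|exact: tame_quasi_periodic].
Qed.
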